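(* Let $c>0$ and let $k_{\mathrm{v}}:\mathbb{R}^3\times\mathbb{R}^3\to\mathbb{R}$ be a positive semidefinite function that is continuous and stationary, i.e. $k_{\mathrm{v}}(x,x')=k_S(x-x')$ for some function $k_S:\mathbb{R}^3\to\mathbb{R}$. For $t\in\mathbb{R}$ let $F_t$ be the Green's function of the 3D wave equation at time $t$ (a measure on $\mathbb{R}^3$, see context), and for $z=(x,t)$, $z'=(x',t')$ in $\mathbb{R}^3\times\mathbb{R}$ put $k_{\mathrm{v}}^{\mathrm{wave}}(z,z')=[(F_t\otimes F_{t'})*k_{\mathrm{v}}](x,x')$. Then: (i) $k_{\mathrm{v}}^{\mathrm{wave}}$ is stationary in space (for fixed $t,t'$ it depends on $(x,x')$ only through $x-x'$) and, for all $x,x'\in\mathbb{R}^3$ and $t,t'\in\mathbb{R}$, $$[(F_t\otimes F_{t'})*k_{\mathrm{v}}](x,x')=(F_t*F_{t'}*k_S)(x-x').$$ (ii) For all $t,t'\in\mathbb{R}$ the measure $F_t*F_{t'}$ is absolutely continuous with respect to Lebesgue measure on $\mathbb{R}^3$ and, identifying $F_t*F_{t'}$ with its density, $$(F_t*F_{t'})(h)=\frac{\mathrm{sgn}(t)\,\mathrm{sgn}(t')}{8\pi c^2|h|}\,\mathbf{1}_{[\,c\,||t|-|t'||,\ c(|t|+|t'|)\,]}(|h|),$$ where $|h|$ is the Euclidean norm of $h\in\mathbb{R}^3$.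
   Context: Positive semidefinite functions $k$ are symmetric, and such that $(k(x_i,x_j))_{i,j}$ is a symmetric nonnegative definite matrix for all finite families of points $(x_i)$. $S$ is the unit sphere of $\mathbb{R}^3$, $d\Omega$ its surface measure, $\gamma\in S$ the integration variable. For $t\neq 0$, $F_t=\sigma_{c|t|}/(4\pi c^2t)$, where $\sigma_R$ is the surface measure of the sphere of center $0$ and radius $R$ in $\mathbb{R}^3$. Equivalently, for all $t\in\mathbb{R}$ (with $F_0=0$), $\int f\,dF_t=t\int_S f(c|t|\gamma)\frac{d\Omega}{4\pi}$ for continuous $f$. For a measure $\mu$ and a function $f$, $(\mu*f)(x)=\int f(x-y)\,\mu(dy)$. For two measures, $\mu*\nu$ is the usual convolution of measures, and $\mu\otimes\nu$ is the product measure; thus $[(F_t\otimes F_{t'})*k](x,x')=\int\int k(x-s_1,x'-s_2)\,F_t(ds_1)\,F_{t'}(ds_2)$. $\mathrm{sgn}$ is the sign function, with $\mathrm{sgn}(0)=0$. The notation $\mathbf{1}_A$ is the indicator function of $A$. *)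

(* Defs.v *)
From HB Require Import structures.
From mathcomp Require Import all_boot all_order all_algebra.
From mathcomp Require Import all_classical all_reals all_analysis.
From mathcomp Require Import measurable_realfun.

Set Implicit Arguments.
Unset Strict Implicit.
Unset Printing Implicit Defensive.

Import Order.TTheory GRing.Theory Num.Theory.
Import numFieldNormedType.Exports.

Local Open Scope classical_set_scope.
Local Open Scope ring_scope.

(* R^3 is the product type R * R * R: the library then provides its topology,
   its Borel (product) sigma-algebra, its group structure and its Lebesgue
   measure as a product. The library norm on products is the sup norm, hence
   the separate definition of the Euclidean norm. *)
Notation R3 R := (R * R * R)%type.

Definition norm3 {R : realType} (h : R3 R) : R :=
  Num.sqrt (h.1.1 ^+ 2 + h.1.2 ^+ 2 + h.2 ^+ 2).

(* The library states lebesgue_measure on measurableTypeR R, which has the same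
   measurable sets as R but another display, so that its products are not
   measures on products of R. *)
Section lebesgue1.
Context {R : realType}.

Definition lebesgue1 : set R -> \bar R := lebesgue_measure.

Let lebesgue1_0 : lebesgue1 set0 = 0%E.
Proof. exact: measure0. Qed.

Let lebesgue1_ge0 A : (0 <= lebesgue1 A)%E.
Proof. exact: measure_ge0. Qed.

Let lebesgue1_sigma_additive : semi_sigma_additive lebesgue1.
Proof. exact: (@measure_semi_sigma_additive _ _ _ (@lebesgue_measure R)). Qed.

HB.instance Definition _ := isMeasure.Build _ R R lebesgue1
  lebesgue1_0 lebesgue1_ge0 lebesgue1_sigma_additive.

Let lebesgue1_sigma_finite : sigma_finite setT lebesgue1.
Proof. exact: (sigma_finiteT (@lebesgue_measure R)). Qed.

HB.instance Definition _ := Measure_isSigmaFinite.Build _ R R lebesgue1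
  lebesgue1_sigma_finite.

End lebesgue1.

Definition lebesgue3 {R : realType} : {measure set (R3 R) -> \bar R} :=
  ((@lebesgue1 R \x @lebesgue1 R) \x @lebesgue1 R)%E.

(* kernels *)

Definition nonneg_definite {R : realType} n (M : 'M[R]_n) : Prop :=
  M^T = M /\ forall a : 'cV[R]_n, 0 <= (a^T *m M *m a) ord0 ord0.

Definition psd_kernel {R : realType} {X : Type} (k : X * X -> R) : Prop :=
  (forall x y, k (x, y) = k (y, x)) /\
  forall n (x : 'I_n -> X), nonneg_definite (\matrix_(i, j) k (x i, x j)).

Definition stationary_with {R : realType} (k : R3 R * R3 R -> R)
    (kS : R3 R -> R) : Prop :=
  forall x x', k (x, x') = kS (x - x').

Definition stationary {R : realType} (k : R3 R * R3 R -> R) : Prop :=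
  exists kS, stationary_with k kS.

(* Signed measures: Jordan decomposition with a chosen Hahn decomposition. It
   does not depend on the choice, since two Hahn decompositions differ by null
   sets (Hahn_decomposition_uniq). *)

Section jordan.
Context d {T : measurableType d} {R : realType}.
Variable nu : {charge set T -> \bar R}.

Let hahn := cid (Hahn_decomposition nu).
Let hahn' := cid (svalP hahn).

Definition jpos : {finite_measure set T -> \bar R} := jordan_pos (svalP hahn').
Definition jneg : {finite_measure set T -> \bar R} := jordan_neg (svalP hahn').

Definition cintegral (f : T -> R) : R :=
  \int[jpos]_x f x - \int[jneg]_x f x.

Definition has_density (mu : {measure set T -> \bar R}) (f : T -> R) : Prop :=
  mu.-integrable setT (EFin \o f) /\
  forall A, measurable A -> nu A = (\int[mu]_(x in A) (f x)%:E)%E.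

End jordan.

Section finite_product.
Context d1 d2 {T1 : measurableType d1} {T2 : measurableType d2} {R : realType}.
Variables (m1 : {finite_measure set T1 -> \bar R})
          (m2 : {finite_measure set T2 -> \bar R}).

Definition fprod : set (T1 * T2) -> \bar R := (m1 \x m2)%E.

HB.instance Definition _ := Measure.on fprod.

Let fprod_finite : fin_num_fun fprod.
Proof.
apply: lty_fin_num_fun; rewrite -setXTT [ltLHS]product_measure1E//.
by rewrite lte_mul_pinfty ?fin_num_measure// ltey_eq fin_num_measure.
Qed.

HB.instance Definition _ := Measure_isFinite.Build _ _ _ fprod fprod_finite.

End finite_product.

(* Bilinear extension of the product of measures to signed measures:
   (a - b) x (c - d) = (a x c + b x d) - (a x d + b x c). *)
Definition cprod d1 d2 {T1 : measurableType d1} {T2 : measurableType d2}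
    {R : realType} (mu : {charge set T1 -> \bar R})
    (nu : {charge set T2 -> \bar R}) : {charge set (T1 * T2)%type -> \bar R} :=
  cadd
    (cadd (charge_of_finite_measure (fprod (jpos mu) (jpos nu)))
          (charge_of_finite_measure (fprod (jneg mu) (jneg nu))))
    (copp
      (cadd (charge_of_finite_measure (fprod (jpos mu) (jneg nu)))
            (charge_of_finite_measure (fprod (jneg mu) (jpos nu))))).

Section convolution.
Context {R : realType}.
Implicit Types mu nu : {charge set (R3 R) -> \bar R}.

Definition add3 (z : R3 R * R3 R) : R3 R := z.1 + z.2.

Lemma measurable_add3 : measurable_fun setT add3.
Proof.
apply: measurable_fun_pair; first apply: measurable_fun_pair.
- apply: measurable_funD;
    by do ![exact: measurable_fst | exact: measurable_snd |
            apply: measurableT_comp].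
- apply: measurable_funD;
    by do ![exact: measurable_fst | exact: measurable_snd |
            apply: measurableT_comp].
- apply: measurable_funD;
    by do ![exact: measurable_fst | exact: measurable_snd |
            apply: measurableT_comp].
Qed.

Definition cconv mu nu : set (R3 R) -> \bar R := pushforward (cprod mu nu) add3.

HB.instance Definition _ mu nu := Charge.copy (cconv mu nu)
  (measure_function_pushforward__canonical__charge_Charge
    (cprod mu nu) measurable_add3).

Definition conv3 mu (f : R3 R -> R) (x : R3 R) : R :=
  cintegral mu (fun y => f (x - y)).

Definition conv33 (m : {charge set (R3 R * R3 R)%type -> \bar R})
    (k : R3 R * R3 R -> R) (z : R3 R * R3 R) : R :=
  cintegral m (fun s => k (z - s)).

End convolution.

(* Surface measure of the sphere of center 0 and radius r, in spherical
   coordinates: the area element is the norm r ^+ 2 * sin theta of the cross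
   product of the two partial derivatives of spherical r. *)
Section sphere.
Context {R : realType}.

Definition spherical (r : R) (u : R * R) : R3 R :=
  (r * sin u.1 * cos u.2, r * sin u.1 * sin u.2, r * cos u.1).

Definition angles : set (R * R) := `[0, pi] `*` `[0, 2 * pi].

Variable r : R.

Definition sphere_measure (A : set (R3 R)) : \bar R :=
  (\int[lebesgue1 \x lebesgue1]_(u in angles `&` spherical r @^-1` A)
     (r ^+ 2 * sin u.1)%:E)%E.

Let measurable_angles : measurable angles.
Proof. exact: measurableX. Qed.

Let measurable_fst' : measurable_fun [set: R * R] fst.
Proof. exact: measurable_fst. Qed.

Let measurable_snd' : measurable_fun [set: R * R] snd.
Proof. exact: measurable_snd. Qed.

Let msin : measurable_fun [set: R] sin.
Proof. by apply: continuous_measurable_fun; exact: continuous_sin. Qed.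

Let mcos : measurable_fun [set: R] cos.
Proof. by apply: continuous_measurable_fun; exact: continuous_cos. Qed.

Lemma measurable_spherical : measurable_fun setT (spherical r).
Proof.
apply: measurable_fun_pair; first apply: measurable_fun_pair.
- by apply: measurable_funM; [apply: measurable_funM => //|];
    exact: measurableT_comp.
- by apply: measurable_funM; [apply: measurable_funM => //|];
    exact: measurableT_comp.
- by apply: measurable_funM => //; exact: measurableT_comp.
Qed.

Let mpre A : measurable A -> measurable (angles `&` spherical r @^-1` A).
Proof.
move=> mA; apply: measurableI => //; rewrite -[X in measurable X]setTI.
exact: measurable_spherical.
Qed.

Let mdens : measurable_fun [set: R * R] (fun u => (r ^+ 2 * sin u.1)%:E).
Proof.
apply/measurable_EFinP; apply: measurable_funM => //.
exact: measurableT_comp.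
Qed.

Let dens_ge0 u : angles u -> (0 <= (r ^+ 2 * sin u.1)%:E)%E.
Proof.
move=> [/= + _]; rewrite in_itv/= => u0.
by rewrite lee_fin mulr_ge0 ?sqr_ge0// sin_ge0_pi.
Qed.

Let sphere0 : sphere_measure set0 = 0%E.
Proof. by rewrite /sphere_measure preimage_set0 setI0 integral_set0. Qed.

Let sphere_ge0 A : (0 <= sphere_measure A)%E.
Proof. by apply: integral_ge0 => u [+ _]; exact: dens_ge0. Qed.

Let sphere_sigma_additive : semi_sigma_additive sphere_measure.
Proof.
move=> F mF tF mUF; rewrite /sphere_measure preimage_bigcup setI_bigcupr.
rewrite ge0_integral_bigcup//=.
- apply: is_cvg_ereal_nneg_natsum_cond => n _ _.
  by apply: integral_ge0 => u [+ _]; exact: dens_ge0.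
- by move=> i; exact: mpre.
- exact: measurable_funTS.
- by move=> u [i _ [+ _]]; exact: dens_ge0.
- apply/trivIsetP => i j _ _ ij; rewrite setIACA setIid -preimage_setI.
  by move/trivIsetP : tF => ->//; rewrite preimage_set0 setI0.
Qed.

HB.instance Definition _ := isMeasure.Build _ _ _ sphere_measure
  sphere0 sphere_ge0 sphere_sigma_additive.

Let sphere_finite : fin_num_fun sphere_measure.
Proof.
apply: lty_fin_num_fun.
rewrite [X in (X < _)%E](_ : _ =
  \int[lebesgue1 \x lebesgue1]_(u in angles) (r ^+ 2 * sin u.1)%:E)%E; last first.
  by rewrite /= /sphere_measure preimage_setT setIT.
apply: (@le_lt_trans _ _
  (\int[lebesgue1 \x lebesgue1]_(u in angles) (r ^+ 2)%:E)%E).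
  apply: ge0_le_integral => //=.
  - exact: measurable_funTS.
  - by move=> u _; rewrite lee_fin ler_piMr ?sqr_ge0 ?sin_le1.
rewrite integral_cst// [X in (_ * X)%E]product_measure1E//.
have fin_itv (b : R) : lebesgue1 `[0, b] \is a fin_num.
  by rewrite [lebesgue1 _]lebesgue_measure_itv/=; case: ifP.
by rewrite ltey_eq !fin_numM ?orbT//; exact: fin_itv.
Qed.

HB.instance Definition _ := Measure_isFinite.Build _ _ _ sphere_measure
  sphere_finite.

End sphere.

(* For t != 0 the total mass is t, and green c t has the sign of t. *)
Definition green {R : realType} (c t : R) : {charge set (R3 R) -> \bar R} :=
  if t == 0 as _ return {charge set (R3 R) -> \bar R} then czero
  else cscale (4 * pi * c ^+ 2 * t)^-1
         (charge_of_finite_measure (sphere_measure (c * `|t|))).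

Definition kwave {R : realType} (c : R) (kv : R3 R * R3 R -> R)
    (z z' : R3 R * R) : R :=
  conv33 (cprod (green c z.2) (green c z'.2)) kv (z.1, z'.1).

Definition green_density {R : realType} (c t t' : R) (h : R3 R) : R :=
  Num.sg t * Num.sg t' / (8 * pi * c ^+ 2 * norm3 h) *
  \1_[set` `[c * `| `|t| - `|t'| |, c * (`|t| + `|t'|)]] (norm3 h).

(* Main.v *)
Require Import Defs.
From HB Require Import structures.
From mathcomp Require Import all_boot all_order all_algebra.
From mathcomp Require Import all_classical all_reals all_analysis.
From mathcomp Require Import measurable_realfun ring lra.

Set Implicit Arguments.
Unset Strict Implicit.
Unset Printing Implicit Defensive.

Import Order.TTheory GRing.Theory Num.Theory.
Import numFieldNormedType.Exports.

Local Open Scope classical_set_scope.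
Local Open Scope ring_scope.

(** Up to the factor (4 pi c^2 t)^-1 (4 pi c^2 t')^-1, the convolution of the two Green's
    functions is the law of p + q, where p and q range over the spheres of radii r = c |t| and
    r' = c |t'| with their surface measures. This law is invariant under the reflections in the
    planes through the origin, so it is an average of uniform measures on spheres and only the law
    of |p + q| has to be found ([radial_average]). For a fixed p, the square of |p + q| is
    r^2 + r'^2 + 2 r r' cos t, where cos t is uniform on [-1, 1] by Archimedes' theorem; hence
    |p + q| has a density proportional to s on [|r - r'|, r + r'] ([distance_law]). In polar
    coordinates Lebesgue measure gives the weight 4 pi s^2 to the radius s, and the quotient of the
    two weights is the density 2 pi r r' / |h| of p + q ([sphere_sum]).

    Polar coordinates are reached with substitutions on the line and Tonelli's theorem: the two
    successive substitutions x = y cot t and y = r sin t give the half-plane ([half_plane_polar]),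
    and using this twice gives space ([space_polar]). Lebesgue measure is invariant under a
    reflection because, once one coordinate is replaced by the scalar product u with the normal of
    the mirror, the reflection is a translation that depends on u followed by the change of u into
    - u ([lebesgue3_refl]). The surface measure inherits this invariance, since the measure of a
    piece of sphere is read off from the cone that it spans ([cone_integral], [sphere_isometry]).

    Uniqueness of reflection invariant measures rests on an averaging argument in the style of Haar
    measure, with reflections instead of rotations: if g is uniform on the unit sphere and v is a
    unit vector, then the image of v under the reflection of normal g, weighted by 2 |<g, v>|, is
    uniform ([reflected_point]). The weight is unchanged when v is replaced by this image, which is
    what allows the reflections to be absorbed by an invariant measure.

    For the stationary kernel, (F_t x F_t') * kv at (x, x') integrates kS ((x - x') - (p - q)), and
    the central symmetry of the spheres turns p - q into p + q ([wave_kernelE]). Signs need no case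
    analysis on t and t': every charge involved is a real multiple b m of a positive measure m,
    and its Jordan parts are those of b times m ([jpos_scaled], [jneg_scaled]). *)

(** * Measures with a density, image measures and Tonelli's theorem *)

(** The class of integrands for which Tonelli's theorem and transport along measurable
    maps hold without any integrability condition, integrals being allowed to be infinite. *)
Definition ge0_mfun d (T : measurableType d) (R : realType) (f : T -> \bar R) :=
  measurable_fun setT f /\ forall x, (0 <= f x)%E.

Section density.
Context d (T : measurableType d) (R : realType).
Variables (m : {measure set T -> \bar R}) (w : T -> R).
Hypotheses (mw : measurable_fun setT w) (w0 : forall x, 0 <= w x).

Let dens (A : set T) : \bar R := (\int[m]_(x in A) (w x)%:E)%E.

Let dens0 : dens set0 = 0%E.
Proof. by rewrite /dens integral_set0. Qed.

Let dens_ge0 A : (0 <= dens A)%E.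
Proof. by apply: integral_ge0 => x _; rewrite lee_fin. Qed.

Let mwE : measurable_fun setT (EFin \o w).
Proof. exact/measurable_EFinP. Qed.

Let dens_sigma_additive : semi_sigma_additive dens.
Proof.
move=> F mF tF mUF; rewrite /dens ge0_integral_bigcup//=.
- by apply: is_cvg_ereal_nneg_natsum_cond => n _ _; exact: dens_ge0.
- exact: measurable_funTS.
- by move=> x _; rewrite lee_fin.
Qed.

Definition weighted : {measure set T -> \bar R} :=
  HB.pack dens (isMeasure.Build _ _ _ dens dens0 dens_ge0 dens_sigma_additive).

Lemma weightedE A : weighted A = (\int[m]_(x in A) (w x)%:E)%E.
Proof. by []. Qed.

Import HBNNSimple.

(** Both sides are linear on simple functions and commute with increasing limits. *)
Lemma integral_weighted (f : T -> \bar R) : ge0_mfun f ->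
  (\int[weighted]_x f x = \int[m]_x (f x * (w x)%:E))%E.
Proof.
move=> [mf f0].
pose h := nnsfun_approx measurableT mf.
have hf x : (h n x)%:E @[n --> \oo] --> f x.
  by apply: cvg_nnsfun_approx => // y _; exact: f0.
have ndh x : {homo (fun n => (h n x)%:E) : a b / (a <= b)%N >-> (a <= b)%E}.
  by move=> a b ab; rewrite lee_fin; exact/lefP/nd_nnsfun_approx.
have -> : (\int[weighted]_x f x =
    lim (\int[weighted]_x (h n x)%:E @[n --> \oo]))%E.
  rewrite -monotone_convergence//.
  - by apply: eq_integral => x _; exact/esym/cvg_lim.
  - by move=> n; exact/measurable_EFinP.
  - by move=> n x _; rewrite lee_fin.
have -> : (\int[m]_x (f x * (w x)%:E) =
    lim (\int[m]_x ((h n x)%:E * (w x)%:E) @[n --> \oo]))%E.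
  rewrite -monotone_convergence//.
  - apply: eq_integral => x _; apply/esym/cvg_lim => //.
    by apply: cvgeZr => //; exact: hf.
  - by move=> n; apply: emeasurable_funM => //; exact/measurable_EFinP.
  - by move=> n x _; rewrite mule_ge0// lee_fin.
  - by move=> x _ a b ab; rewrite lee_wpmul2r ?lee_fin//; exact: ndh.
congr (lim (_ @ \oo)); apply/funext => n.
under eq_integral do rewrite fimfunE -fsumEFin//.
rewrite ge0_integral_fsum//; last 2 first.
  - by move=> y; exact/measurable_EFinP/measurable_funM.
  - by move=> y x _; rewrite nnfun_muleindic_ge0.
have -> : (\int[m]_x ((h n x)%:E * (w x)%:E) =
   \int[m]_x (\sum_(y \in range (h n))
     (y * \1_(h n @^-1` [set y]) x)%:E * (w x)%:E))%E.
  apply: eq_integral => x _.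
  rewrite {1}fimfunE -fsumEFin// ge0_mule_fsuml// => y.
  exact: nnfun_muleindic_ge0.
rewrite ge0_integral_fsum//; last 2 first.
  - by move=> y; apply: emeasurable_funM => //; exact/measurable_EFinP/measurable_funM.
  - by move=> y x _; rewrite mule_ge0 ?lee_fin// -lee_fin EFinM nnfun_muleindic_ge0.
apply: eq_fsbigr => y; rewrite inE => -[x _ xy].
have y0 : 0 <= y by rewrite -xy.
rewrite integralZl_indic_nnsfun// integral_indic// setIT weightedE.
under [RHS]eq_integral => t _ do rewrite EFinM -muleA.
rewrite ge0_integralZl//; last first.
  - by move=> t _; rewrite mule_ge0 ?lee_fin.
  - by apply: emeasurable_funM => //; exact/measurable_EFinP.
congr (_ * _)%E; rewrite integral_mkcond; apply: eq_integral => t _.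
rewrite patchE indicE; case: ifPn; rewrite ?mul1e ?mul0e//.
Qed.

End density.

Lemma measurable_inv (R : realType) : measurable_fun setT (@GRing.inv R).
Proof.
have o1 : measurable [set~ (0 : R)] by exact: measurableC.
have -> : [set: R] = [set 0] `|` [set~ 0] by rewrite setUv.
apply/measurable_funU => //; split; first exact: measurable_fun_set1.
apply: open_continuous_measurable_fun.
  exact/closed_openC/accessible_closed_set1/hausdorff_accessible/Rhausdorff.
by move=> x /set_mem /eqP x0; exact: inv_continuous.
Qed.

Section measurable_pointwise.
Context d (T : measurableType d) (R : realType).
Implicit Types f : T -> R.

Lemma mfun_opp f : measurable_fun setT f -> measurable_fun setT (fun x => - f x).
Proof. by move=> mf; apply: measurableT_comp mf; exact: oppr_measurable. Qed.

Lemma mfun_inv f : measurable_fun setT f -> measurable_fun setT (fun x => (f x)^-1).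
Proof. by move=> mf; apply: measurableT_comp mf; exact: measurable_inv. Qed.

Lemma mfun_norm f : measurable_fun setT f -> measurable_fun setT (fun x => `|f x|).
Proof. by move=> mf; apply: measurableT_comp mf; exact: normr_measurable. Qed.

Lemma mfun_sqrt f : measurable_fun setT f ->
  measurable_fun setT (fun x => Num.sqrt (f x)).
Proof.
move=> mf; apply: measurableT_comp mf.
by apply: continuous_measurable_fun; exact: sqrt_continuous.
Qed.

Lemma mfun_sin f : measurable_fun setT f -> measurable_fun setT (fun x => sin (f x)).
Proof.
move=> mf; apply: measurableT_comp mf.
by apply: continuous_measurable_fun; exact: continuous_sin.
Qed.

Lemma mfun_cos f : measurable_fun setT f -> measurable_fun setT (fun x => cos (f x)).
Proof.
move=> mf; apply: measurableT_comp mf.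
by apply: continuous_measurable_fun; exact: continuous_cos.
Qed.

Lemma mfun_indic f (A : set R) : measurable A ->
  measurable_fun setT f -> measurable_fun setT (fun x => \1_A (f x) : R).
Proof. by move=> mA mf; apply: measurableT_comp mf; exact: measurable_indic. Qed.

Lemma measurable_indicator (A : set T) : measurable A ->
  measurable_fun setT (\1_A : T -> R).
Proof. by move=> mA; exact: measurable_indic. Qed.

End measurable_pointwise.

Section tonelli.
Context d1 d2 (T1 : measurableType d1) (T2 : measurableType d2) (R : realType).
Variables (m1 : {sigma_finite_measure set T1 -> \bar R})
          (m2 : {sigma_finite_measure set T2 -> \bar R}).
Variable F : T1 -> T2 -> \bar R.
Hypothesis nF : ge0_mfun (fun z => F z.1 z.2).

Lemma integral_swap :
  (\int[m1]_x \int[m2]_y F x y = \int[m2]_y \int[m1]_x F x y)%E.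
Proof. by have [mF F0] := nF; exact: (fubini_tonelli (fun z => F z.1 z.2)). Qed.

Lemma integral_prod :
  (\int[m1 \x m2]_z F z.1 z.2 = \int[m1]_x \int[m2]_y F x y)%E.
Proof. by have [mF F0] := nF; exact: (fubini_tonelli1 (fun z => F z.1 z.2)). Qed.

Lemma mfun_integral : measurable_fun setT (fun x => (\int[m2]_y F x y)%E).
Proof.
have [mF F0] := nF.
exact: (measurable_fun_fubini_tonelli_F (fun z => F z.1 z.2)).
Qed.

Lemma ge0_mfun_integral : ge0_mfun (fun x => (\int[m2]_y F x y)%E).
Proof.
split; first exact: mfun_integral.
by move=> x; apply: integral_ge0 => y _; have [_ F0] := nF; exact: (F0 (x, y)).
Qed.

End tonelli.

Lemma indic_ge0 (T : Type) (R : realType) (A : set T) x : 0 <= \1_A x :> R.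
Proof. by rewrite indicE ler0n. Qed.

(** Extension point of [nneg] for nonnegative functions introduced further on. *)
Ltac nneg_hook := fail.

Ltac nneg := intros; repeat first
  [ assumption | nneg_hook | exact: indic_ge0 | exact: ler01 | exact: ler0n
  | lazymatch goal with
    | H : ge0_mfun ?F |- is_true (@Order.le _ _ _ (?F _)) => apply: (proj2 H)
    | H : forall x, is_true (_ <= ?F x)%R |- is_true (@Order.le _ _ _ (?F _)) => apply: H
    | H : forall x, is_true (_ <= ?F x)%E |- is_true (@Order.le _ _ _ (?F _)) => apply: H
    | |- is_true (@Order.le _ _ _ (_ * _)%E) => apply: mule_ge0
    | |- is_true (@Order.le _ _ _ (_ + _)%E) => apply: adde_ge0
    | |- is_true (@Order.le _ _ _ (_%:E)%E) => rewrite lee_fin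
    | |- is_true (@Order.le _ _ _ (_ * _)%R) => apply: mulr_ge0
    | |- is_true (@Order.le _ _ _ (_ + _)%R) => apply: addr_ge0
    | |- is_true (@Order.le _ _ _ (_ ^+ 2)%R) => apply: sqr_ge0
    | |- is_true (@Order.le _ _ _ (_ ^+ _)%R) => apply: exprn_ge0
    | |- is_true (@Order.le _ _ _ (`|_|)%R) => apply: normr_ge0
    | |- is_true (@Order.le _ _ _ (Num.sqrt _)%R) => apply: sqrtr_ge0
    | |- is_true (@Order.le _ _ _ (_^-1)%R) => rewrite invr_ge0
    | |- is_true (@Order.le _ _ _ (\int[_]_(_ in _) _)%E) => apply: integral_ge0; intros
    end ].

(** Measurability by recursion on the body of a function; variables applied to
    arguments are handled with the [ge0_mfun] and [measurable_fun] hypotheses about them. *)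
Ltac mfun := repeat (lazymatch goal with
  | |- measurable_fun _ (fun _ => ?c) => exact: measurable_cst
  | |- measurable_fun _ (fun x => x) => exact: measurable_id
  | H : ge0_mfun ?F |- measurable_fun _ ?F => exact: (proj1 H)
  | H : measurable_fun setT ?F |- measurable_fun _ ?F =>
      first [exact: H | exact: measurable_funTS]
  | |- measurable_fun _ fst => exact: measurable_fst
  | |- measurable_fun _ snd => exact: measurable_snd
  | |- measurable_fun _ (fun x => (@?f x, @?g x)) =>
      apply: (@measurable_fun_pair _ _ _ _ _ _ f g)
  | |- measurable_fun _ (fun x => (@?f x + @?g x)%R) =>
      apply: (@measurable_funD _ _ _ _ f g)
  | |- measurable_fun _ (fun x => (@?f x * @?g x)%R) =>
      apply: (@measurable_funM _ _ _ _ f g)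
  | |- measurable_fun _ (fun x => @?f x ^+ ?n) =>
      apply: (@measurable_funX _ _ _ _ f n)
  | |- measurable_fun _ (fun x => (@?f x * @?g x)%E) =>
      apply: (@emeasurable_funM _ _ _ _ f g)
  | |- measurable_fun _ (fun x => (@?f x + @?g x)%E) =>
      apply: (@emeasurable_funD _ _ _ _ f g)
  | |- measurable_fun _ (fun x => (@?f x)%:E) =>
      apply/(@measurable_EFinP _ _ _ _ f)
  | |- measurable_fun _ (fun x => (@?f x).1) =>
      apply: (@measurableT_comp _ _ _ _ _ _ fst _ f)
  | |- measurable_fun _ (fun x => (@?f x).2) =>
      apply: (@measurableT_comp _ _ _ _ _ _ snd _ f)
  | H : ge0_mfun ?F |- measurable_fun _ (fun x => ?F (@?f x)) =>
      apply: (@measurableT_comp _ _ _ _ _ _ F _ f)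
  | H : measurable_fun setT ?F |- measurable_fun _ (fun x => ?F (@?f x)) =>
      apply: (@measurableT_comp _ _ _ _ _ _ F _ f)
  | |- measurable_fun _ (fun x => sin _) => apply: mfun_sin
  | |- measurable_fun _ (fun x => cos _) => apply: mfun_cos
  | |- measurable_fun _ (fun x => integral ?m setT (@?F x)) =>
      apply: (@mfun_integral _ _ _ _ _ m F); split; [cbn beta|nneg]
  | |- _ => first [apply: mfun_opp | apply: mfun_inv | apply: mfun_norm
                  | apply: mfun_sqrt | apply: mfun_sin | apply: mfun_cos
                  | by apply: measurable_indicator
                  | apply: mfun_indic; first by []]
  end).

Ltac ge0mfun := split; [mfun | nneg].

Lemma measurable_idR (R : realType) :
  measurable_fun setT (idfun : R -> measurableTypeR R).
Proof. by move=> _ A mA; rewrite setTI. Qed.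

(** [lebesgue1] and [lebesgue_measure] are one set function on two measurable types that
    differ by their display; the identity map transports integrals between them. *)
Lemma integral_lebesgue1 (R : realType) (D : set R) (f : R -> \bar R) :
  measurable D -> measurable_fun D f -> (forall x, D x -> (0 <= f x)%E) ->
  (\int[lebesgue1]_(x in D) f x = \int[lebesgue_measure]_(x in D) f x)%E.
Proof.
move=> mD mf f0.
have := @ge0_integral_pushforward _ _ _ _ _ _ (@measurable_idR R) (@lebesgue1 R) D f mD mf.
by move=> /(_ _) <- //; move=> x /set_mem; exact: f0.
Qed.

Section push.
Context d d' (T : measurableType d) (T' : measurableType d') (R : realType).
Variables (m : {measure set T -> \bar R}) (G : T -> T').
Hypothesis mG : measurable_fun setT G.

Definition pushm : {measure set T' -> \bar R} :=
  measure_function_pushforward__canonical__measure_function_Measure m mG.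

Lemma integral_pushm (f : T' -> \bar R) : ge0_mfun f ->
  (\int[pushm]_y f y = \int[m]_x f (G x))%E.
Proof.
move=> [mf f0].
rewrite (@ge0_integral_pushforward _ _ _ _ _ _ mG m setT f)//.
Qed.

End push.

(** Changes of variables reduce to indicators: these determine the image under G of the
    measure of density w, and integration against an image measure is composition. *)
Lemma integral_push_weighted d d' (T : measurableType d) (T' : measurableType d')
    (R : realType) (m : {measure set T -> \bar R}) (n : {measure set T' -> \bar R})
    (G : T -> T') (w : T -> R) (mG : measurable_fun setT G)
    (mw : measurable_fun setT w) (w0 : forall x, 0 <= w x) :
  (forall A, measurable A -> \int[m]_x (\1_A (G x) * w x)%:E = n A)%E ->
  forall f, ge0_mfun f -> (\int[m]_x (f (G x) * (w x)%:E) = \int[n]_y f y)%E.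
Proof.
move=> h f nf.
have nfG : ge0_mfun (fun x => f (G x)) by ge0mfun.
rewrite -(integral_weighted m mw w0 nfG) -(integral_pushm _ mG nf).
apply: eq_measure_integral => A mA _; rewrite -h//.
rewrite /= /pushforward /= integral_mkcond; apply: eq_integral => x _.
have memG : (x \in G @^-1` A) = (G x \in A).
  by apply/idP/idP => /set_mem ?; exact/mem_set.
rewrite patchE indicE memG; by case: ifPn; rewrite ?mul1r ?mul0r.
Qed.

(** * Changes of variables on the line *)

Lemma lebesgue1_itv (R : realType) (a b : R) (x y : bool) : a <= b ->
  lebesgue1 [set` Interval (BSide x a) (BSide y b)] = (b - a)%:E.
Proof.
move=> ab; rewrite [lebesgue1 _]lebesgue_measure_itv/= lte_fin.
case: ifPn => [_|]; first by rewrite EFinB.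
by rewrite -leNgt => ba; congr EFin; lra.
Qed.

(** The rays open on the left form a generating pi-system. They suit increasing changes of
    variables on a segment, where the preimage of a ray is an interval that ends at the right
    end point. *)
Lemma measure_ray_unique (R : realType) (m1 m2 : {measure set R -> \bar R}) :
  (forall y : R, m1 `]y, +oo[%classic = m2 `]y, +oo[%classic) ->
  (forall y : R, (m2 `]y, +oo[%classic < +oo)%E) ->
  forall A, measurable A -> m1 A = m2 A.
Proof.
move=> m12 m2oo; apply: (measure_unique (@RGenOInfty.G R) (fun k => `]- k%:R, +oo[%classic)).
  exact: (RGenOInfty.measurableE R).
- move=> _ _ [a ->] [b ->]; exists (Num.max a b).
  apply/seteqP; split => x /=; rewrite !in_itv/= !andbT gt_max.
    by move=> [-> ->].
  by move=> /andP[].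
- by move=> k; exists (- k%:R).
- apply/seteqP; split => // x _; exists (Num.truncn `|x|).+1 => //=.
  by rewrite in_itv/= andbT ltrNl (le_lt_trans _ (truncnS_gt _))// -normrN ler_norm.
- by move=> _ [a ->]; exact: m12.
- by move=> k; rewrite m12.
Qed.

Lemma integral_mkindic d (T : measurableType d) (R : realType)
    (m : {measure set T -> \bar R}) (D : set T) (f : T -> \bar R) :
  (\int[m]_(x in D) f x = \int[m]_x (f x * (\1_D x)%:E))%E.
Proof.
rewrite integral_mkcond; apply: eq_integral => x _.
by rewrite patchE indicE; case: ifPn; rewrite ?mule1 ?mule0.
Qed.

Lemma integral_derive_itv (R : realType) (a b : R) (G g : R -> R) : a <= b ->
  (forall x, a <= x <= b -> is_derive x 1 G (g x)) ->
  (forall x, a <= x <= b -> {for x, continuous g}) ->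
  (\int[lebesgue_measure]_(x in `[a, b]) (g x)%:E = (G b - G a)%:E)%E.
Proof.
rewrite le_eqVlt => /predU1P[-> _ _|ab dG cg].
  by rewrite set_itv1 integral_set1 subrr.
have cG x : a <= x <= b -> {for x, continuous G}.
  by move=> /dG xG; apply/differentiable_continuous/derivable1_diffP.
rewrite EFinB (@continuous_FTC2 _ g G)//.
- apply: continuous_in_subspaceT => x /set_mem/= /[!in_itv]/=; exact: cg.
- split.
  + by move=> x /[!in_itv]/= /andP[ax xb]; have [] := dG x; rewrite ?(ltW ax) ?(ltW xb).
  + by apply: cvg_at_right_filter; apply: cG; rewrite lexx ltW.
  + by apply: cvg_at_left_filter; apply: cG; rewrite lexx ltW.
- move=> x /[!in_itv]/= /andP[ax xb].
  rewrite derive1E; have xG : is_derive x 1 G (g x) by apply: dG; rewrite !ltW.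
  exact: derive_val.
Qed.

(** The two measures compared below are finite and agree on rays by the fundamental theorem
    of calculus, so the integrand of the substitution rule only has to be measurable. *)
Section increasing_substitution.
Context {R : realType} (p q : R) (G g : R -> R).
Hypotheses (pq : p <= q) (mG : measurable_fun setT G) (mg : measurable_fun setT g).
Hypothesis dG : forall x, p <= x <= q -> is_derive x 1 G (g x).
Hypothesis cg : forall x, p <= x <= q -> {for x, continuous g}.
Hypothesis g0 : forall x, p <= x <= q -> 0 <= g x.
Hypothesis incG : {in `[p, q] &, {homo G : x y / x < y}}.

Let w x := g x * \1_(`[p, q]%classic) x.

Let mw : measurable_fun setT w.
Proof. by rewrite /w; mfun. Qed.

Let w0 x : 0 <= w x.
Proof.
rewrite /w indicE; have [/set_mem/=|_] := boolP (x \in _); last by rewrite mulr0.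
by rewrite in_itv/= mulr1; exact: g0.
Qed.

Let cG x : p <= x <= q -> {for x, continuous G}.
Proof. by move=> /dG xG; apply/differentiable_continuous/derivable1_diffP. Qed.

Let leG x y : p <= x <= q -> p <= y <= q -> x <= y -> G x <= G y.
Proof.
move=> px py; rewrite le_eqVlt => /predU1P[->//|xy].
by apply: ltW; have := incG; apply; rewrite ?in_itv.
Qed.

Let total := weighted lebesgue1 (measurable_indicator (measurable_itv `[G p, G q]))
  (@indic_ge0 R R _).

(* The boolean x is the kind of the left end: closed for a whole segment, open for a ray. *)
Let totalE (a : R) (x : bool) A : G p <= a <= G q -> measurable A ->
  A `&` `[G p, G q]%classic = [set` Interval (BSide x a) (BRight (G q))] ->
  total A = (G q - a)%:E.
Proof.
move=> /andP[_ aq] mA AE.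
by rewrite weightedE integral_indic// setIC AE; exact: lebesgue1_itv.
Qed.

Let pushE (a : R) (x : bool) A : p <= a <= q -> measurable A ->
  (G @^-1` A) `&` `[p, q]%classic = [set` Interval (BSide x a) (BRight q)] ->
  pushm (weighted lebesgue1 mw w0) mG A = (G q - G a)%:E.
Proof.
move=> /andP[pa aq] mA AE.
have mGA : measurable (G @^-1` A) by rewrite -[X in measurable X]setTI; exact: mG.
transitivity (\int[lebesgue1]_(x in [set` Interval (BSide x a) (BRight q)]) (g x)%:E)%E.
  rewrite -AE [RHS]integral_mkindic [LHS]integral_mkindic.
  apply: eq_integral => z _; rewrite -!EFinM; congr EFin.
  by rewrite indicI /w /= -mulrA; congr (_ * _); rewrite mulrC.
have sub z : a <= z <= q -> p <= z <= q.
  by move=> /andP[az ->]; rewrite (le_trans pa az).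
rewrite integral_lebesgue1//.
- have <- := integral_derive_itv aq (fun z h => dG (sub z h)) (fun z h => cg (sub z h)).
  have mo : measurable_fun `]a, q[ (fun x => (g x)%:E).
    by apply: measurable_funTS; mfun.
  by rewrite integral_itv_bndoo// [RHS]integral_itv_bndoo.
- by apply: measurable_funTS; mfun.
- move=> z; rewrite /= in_itv /= => /andP[az zq]; rewrite lee_fin g0// zq andbT.
  by apply: le_trans pa _; case: x az {AE} => //= /ltW.
Qed.

Let push_ray y : pushm (weighted lebesgue1 mw w0) mG `]y, +oo[%classic =
  total `]y, +oo[%classic.
Proof.
have pp : p <= p <= q by rewrite lexx.
have qq : p <= q <= q by rewrite lexx pq.
have Gpq : G p <= G q by exact: leG.
have [yGp|Gpy] := ltP y (G p).
  rewrite (@pushE p true)//; first rewrite (@totalE (G p) true)//.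
  - by rewrite lexx.
  - apply/seteqP; split => z /=; rewrite !in_itv/= ?andbT; first by case.
    by move=> /andP[pz zq]; rewrite pz zq (lt_le_trans yGp pz).
  - apply/seteqP; split => z /=; rewrite !in_itv/= ?andbT; first by case.
    move=> /andP[pz zq]; split; last by rewrite pz zq.
    by rewrite (lt_le_trans yGp)// leG// pz zq.
have [yGq|Gqy] := ltP y (G q); last first.
  rewrite (@pushE q false)//; first rewrite (@totalE (G q) false)//.
  - by rewrite lexx andbT.
  - apply/seteqP; split => z /=; rewrite !in_itv/= ?andbT; last by lra.
    by move=> [? /andP[]]; lra.
  - apply/seteqP; split => z /=; rewrite !in_itv/= ?andbT; last by lra.
    move=> [yz /andP[pz zq]].
    have : G z <= G q by apply: leG; rewrite // pz zq.
    by lra.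
have [xi] : exists2 xi, xi \in `[p, q] & G xi = y.
  apply: IVT => //; last by rewrite min_l// max_r// Gpy ltW.
  apply: continuous_in_subspaceT => x /set_mem/= /[!in_itv]/=; exact: cG.
rewrite in_itv => pxi Gxi.
have [p_xi xi_q] : p <= xi /\ xi <= q by apply/andP.
rewrite (@totalE y false)//; first rewrite (@pushE xi false)//.
- by rewrite Gxi.
- apply/seteqP; split => z /=; rewrite !in_itv/= ?andbT.
    move=> [yz /andP[pz zq]]; rewrite zq andbT ltNge; apply/negP => zxi.
    have : G z <= G xi by apply: leG; rewrite // pz zq.
    by lra.
  move=> /andP[xiz zq].
  have pz : p <= z by lra.
  split; last by rewrite pz zq.
  by rewrite -Gxi; have := incG; apply; rewrite ?in_itv /= ?pz.
- by rewrite Gpy ltW.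
- apply/seteqP; split => z /=; rewrite !in_itv/= ?andbT; first by lra.
  by move=> /andP[yz zG]; split => //; rewrite zG andbT; lra.
Qed.

Let total_fin y : (total `]y, +oo[%classic < +oo)%E.
Proof.
rewrite weightedE integral_indic//.
apply: (@le_lt_trans _ _ (lebesgue1 `[G p, G q]%classic)).
  by apply: le_measure; rewrite ?inE//; exact: measurableI.
by rewrite lebesgue1_itv ?ltry//; apply: leG; rewrite ?lexx ?pq.
Qed.

Lemma incr_substitution (f : R -> \bar R) : ge0_mfun f ->
  (\int[lebesgue1]_x (f (G x) * (g x * \1_(`[p, q]%classic) x)%:E) =
   \int[lebesgue1]_(y in `[G p, G q]) f y)%E.
Proof.
move=> nf.
rewrite [RHS]integral_mkindic.
have nfG : ge0_mfun (fun x => f (G x)) by ge0mfun.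
rewrite -(integral_weighted lebesgue1 mw w0 nfG) -(integral_pushm _ mG nf).
rewrite -(integral_weighted lebesgue1 (measurable_indicator (measurable_itv `[G p, G q])) (@indic_ge0 R R _) nf).
apply: eq_measure_integral => A mA _.
exact: measure_ray_unique push_ray total_fin _ mA.
Qed.

End increasing_substitution.

(** On the whole line the measures of rays are infinite, and bounded half-open intervals
    replace them. *)
Section substitution_line.
Context {R : realType} (G w : R -> R).
Hypotheses (mG : measurable_fun setT G) (mw : measurable_fun setT w).
Hypothesis w0 : forall x, 0 <= w x.

Lemma substitution_ocitv :
  (forall a b : R, a < b ->
    (\int[lebesgue1]_x (\1_(`]a, b]%classic) (G x) * w x)%:E)%E = (b - a)%:E) ->
  forall f, ge0_mfun f -> (\int[lebesgue1]_x (f (G x) * (w x)%:E) = \int[lebesgue1]_y f y)%E.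
Proof.
move=> h; apply: integral_push_weighted => // A mA.
have E (B : set R) : measurable B ->
    pushm (pushm (weighted lebesgue1 mw w0) mG) (@measurable_idR R) B =
    (\int[lebesgue1]_x (\1_B (G x) * w x)%:E)%E.
  move=> mB; transitivity (weighted lebesgue1 mw w0 (G @^-1` B)) => //.
  rewrite weightedE integral_mkindic; apply: eq_integral => x _.
  by rewrite -EFinM mulrC !indicE.
rewrite -E//; apply/esym; apply: lebesgue_measure_unique => // _ [[a b] _ <-].
have mab : measurable (`]a, b]%classic : set R) by [].
rewrite [RHS](E _ mab) [LHS](@lebesgue_measure_itv R `]a, b])/= lte_fin.
have [ab|ba] := ltP a b; first by rewrite h// EFinB.
rewrite integral0_eq// => x _; rewrite set_itv_ge ?bnd_simp -?leNgt//.
by rewrite indic0 mul0r.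
Qed.

End substitution_line.

Lemma substitution_affine (R : realType) (a b : R) (f : R -> \bar R) :
  a != 0 -> ge0_mfun f ->
  (\int[lebesgue1]_x (f (a * x + b)%R * `|a|%:E) = \int[lebesgue1]_x f x)%E.
Proof.
move=> a0; apply: (@substitution_ocitv R (fun x => a * x + b) (fun=> `|a|)).
- by mfun.
- by mfun.
- by move=> ?; exact: normr_ge0.
move=> u v uv.
have I (x y : bool) (u' v' : R) : u' <= v' ->
    (forall z, (u < a * z + b <= v) = (z \in Interval (BSide x u') (BSide y v'))) ->
    (v' - u') * `|a| = v - u ->
    (\int[lebesgue1]_z (\1_(`]u, v]%classic) (a * z + b)%R * `|a|)%:E)%E = (v - u)%:E.
  move=> uv' H <-.
  have mI : measurable [set` Interval (BSide x u') (BSide y v')] by [].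
  transitivity (\int[lebesgue1]_z ((\1_[set` Interval (BSide x u') (BSide y v')] z)%:E * `|a|%:E))%E.
    apply: eq_integral => z _; rewrite -EFinM !indicE; congr ((nat_of_bool _)%:R * _)%:E.
    have HH : (a * z + b \in `]u, v]) = (z \in Interval (BSide x u') (BSide y v')).
      by rewrite -H in_itv.
    apply/idP/idP => /set_mem h; apply/mem_set; first by rewrite /= -HH.
    by rewrite /= HH.
  rewrite ge0_integralZr//.
  - by rewrite integral_indic// setIT EFinM; congr (_ * _)%E; exact: lebesgue1_itv.
  - by apply/measurable_EFinP; exact: measurable_indic.
have [a_gt0|a_lt0|a00] := ltgtP 0 a; last by rewrite -a00 eqxx in a0.
- apply: (I false false ((u - b) / a) ((v - b) / a)).
  + by rewrite ler_pM2r ?invr_gt0// lerD2r ltW.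
  + by move=> z; rewrite in_itv/= ltr_pdivrMr// ler_pdivlMr// ltrBlDr lerBrDr (mulrC z).
  + by rewrite (gtr0_norm a_gt0) -mulrBl mulfVK//; lra.
- apply: (I true true ((v - b) / a) ((u - b) / a)).
  + by rewrite ler_nM2r ?invr_lt0// lerD2r ltW.
  + move=> z; rewrite in_itv/= ler_ndivrMr// ltr_ndivlMr// lerBrDr ltrBlDr (mulrC z).
    by rewrite andbC.
  + by rewrite (ltr0_norm a_lt0) -mulrBl mulrN mulfVK//; lra.
Qed.

(** The opposite of the cotangent: it increases from -oo to +oo on ]0, pi[. *)
Definition ncot {R : realType} (x : R) := - (cos x / sin x).

Lemma is_derive_ncot (R : realType) (x : R) : sin x != 0 ->
  is_derive x 1 (@ncot R) ((sin x) ^- 2).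
Proof.
move=> sx; rewrite /ncot.
have -> : (fun x : R => - (cos x / sin x)) = - (cos * (fun x => (sin x)^-1)).
  by [].
apply: is_derive_eq; rewrite /GRing.scale/=.
transitivity ((cos x ^+ 2 + sin x ^+ 2) / sin x ^+ 2); first by field.
by rewrite cos2Dsin2 mul1r.
Qed.

Lemma ltr_ncot (R : realType) (x y : R) : 0 < x -> x < y -> y < pi -> ncot x < ncot y.
Proof.
move=> x0 xy yp.
have sx : 0 < sin x by rewrite sin_gt0_pi// x0 (lt_trans xy).
have sy : 0 < sin y by rewrite sin_gt0_pi// yp (lt_trans x0).
rewrite -subr_gt0.
have -> : ncot y - ncot x = sin (y - x) / (sin x * sin y).
  by rewrite sinB /ncot; field; rewrite !gt_eqF.
by rewrite divr_gt0 ?mulr_gt0// sin_gt0_pi// subr_gt0 xy/=; lra.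
Qed.

Lemma ncot_atan (R : realType) (u : R) :
  let p := pi / 2 + atan u in 0 < p < pi /\ ncot p = u.
Proof.
move=> p; have := atan_gtNpi2 u; have := atan_ltpi2 u => h1 h2.
split; first by rewrite /p; apply/andP; split; lra.
rewrite /ncot /p cosD sinD cos_pihalf sin_pihalf !mul0r !mul1r sub0r addr0.
by rewrite mulNr opprK -[RHS](atanK u).
Qed.

Definition pi_itv {R : realType} : set R := `]0, pi[%classic.

(** On the segment between the preimages of a and b this is the substitution rule for
    increasing functions, and monotonicity confines the preimage of ]a, b] to that segment. *)
Lemma substitution_ncot (R : realType) (f : R -> \bar R) : ge0_mfun f ->
  (\int[lebesgue1]_x (f (ncot x) * ((sin x) ^- 2 * \1_pi_itv x)%:E) =
   \int[lebesgue1]_y f y)%E.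
Proof.
have measurable_pi_itv : measurable (@pi_itv R) by exact: measurable_itv.
have mncot : measurable_fun setT (@ncot R) by rewrite /ncot; mfun.
have ms : measurable_fun setT (fun x : R => (sin x) ^- 2) by mfun.
have s0 (x : R) : 0 <= (sin x) ^- 2 by nneg.
apply: (@substitution_ocitv R ncot (fun x => (sin x) ^- 2 * \1_pi_itv x)).
- exact: mncot.
- by mfun.
- by nneg.
move=> u v uv.
(* Since - cot (pi / 2 + s) = tan s, the preimage of u is pi / 2 + atan u. *)
have [/andP[p0 ppi] pu] := ncot_atan u; have [/andP[q0 qpi] qv] := ncot_atan v.
set p := _ + atan u in p0 ppi pu; set q := _ + atan v in q0 qpi qv.
have pq : p < q by rewrite ltrD2l lt_atan.
have spq x : p <= x <= q -> 0 < sin x.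
  by move=> /andP[px xq]; rewrite sin_gt0_pi// (lt_le_trans p0)// (le_lt_trans xq).
have nI : ge0_mfun (fun x : R => (\1_(`]u, v]%classic) x)%:E : \bar R).
  by split; [apply/measurable_EFinP; exact: measurable_indic|nneg].
transitivity (\int[lebesgue1]_x ((\1_(`]u, v]%classic) (ncot x))%:E *
    ((sin x) ^- 2 * \1_(`[p, q]%classic) x)%:E))%E.
  apply: eq_integral => x _; rewrite -EFinM; congr EFin.
  rewrite !indicE.
  have [/set_mem/=|_] := boolP (ncot x \in _); last by rewrite !mul0r.
  rewrite in_itv/= -{1}pu -{1}qv => /andP[pcx cxq].
  congr (_ * (_ * (nat_of_bool _)%:R)).
  rewrite /pi_itv !mem_setE !in_itv/=; apply/idP/idP => /andP[x1 x2].
    rewrite leNgt [x <= q]leNgt; apply/andP; split; apply/negP => h.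
      by have := ltr_ncot x1 h ppi; lra.
    by have := ltr_ncot q0 h x2; lra.
  by rewrite (lt_le_trans p0)// (le_lt_trans x2).
rewrite [LHS](_ : _ =
    \int[lebesgue1]_(y in `[ncot p, ncot q]) (\1_(`]u, v]%classic) y)%:E)%E.
  rewrite pu qv integral_indic// setIidl; first exact/lebesgue1_itv/ltW.
  by move=> x /=; rewrite !in_itv/= => /andP[/ltW -> ->].
apply: (@incr_substitution R p q ncot (fun x => (sin x) ^- 2)) => //.
- by rewrite ltW.
- by move=> x /spq sx; apply: is_derive_ncot; rewrite gt_eqF.
- move=> x /spq sx; apply: continuousV; first by rewrite expf_neq0// gt_eqF.
  apply: (@continuous_comp _ _ _ sin (fun y => y ^+ 2)); first exact: continuous_sin.
  exact: exprn_continuous.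
- move=> x y; rewrite !in_itv/= => /andP[px _] /andP[_ yq] xy.
  by apply: ltr_ncot => //; [exact: lt_le_trans px|exact: le_lt_trans qpi].
Qed.

(** * Polar coordinates in the plane *)

Section constants.
Context d (T : measurableType d) (R : realType) (m : {measure set T -> \bar R}).
Variables (f : T -> \bar R) (c : R).
Hypotheses (nf : ge0_mfun f) (c0 : 0 <= c).

Lemma ge0_mfun_integralZr : (\int[m]_x (f x * c%:E) = (\int[m]_x f x) * c%:E)%E.
Proof. by have [mf f0] := nf; rewrite ge0_integralZr. Qed.

Lemma ge0_mfun_integralZl : (\int[m]_x (c%:E * f x) = c%:E * \int[m]_x f x)%E.
Proof. by have [mf f0] := nf; rewrite ge0_integralZl. Qed.

End constants.

Definition pos_itv {R : realType} : set R := `]0, +oo[%classic.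

Lemma measurable_pos_itv (R : realType) : measurable (@pos_itv R).
Proof. exact: measurable_itv. Qed.

Lemma measurable_pi_itv (R : realType) : measurable (@pi_itv R).
Proof. exact: measurable_itv. Qed.

#[local] Hint Resolve measurable_pos_itv measurable_pi_itv : core.

Lemma indic_pos (R : realType) (x : R) : 0 < x -> \1_pos_itv x = 1 :> R.
Proof. by move=> x0; rewrite indicE mem_setE in_itv/= x0. Qed.

Lemma indic_npos (R : realType) (x : R) : x <= 0 -> \1_pos_itv x = 0 :> R.
Proof.
by move=> x0; rewrite indicE mem_setE in_itv/= andbT ltNge x0.
Qed.

Lemma indic_pi_cases (R : realType) (x : R) :
  (0 < sin x /\ \1_pi_itv x = 1 :> R) \/ \1_pi_itv x = 0 :> R.
Proof.
rewrite indicE mem_setE in_itv/=.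
by case: (boolP (0 < x < pi)) => [/sin_gt0_pi|]; [left|right].
Qed.

(** Substituting first x = y cot t at fixed y, then y = r sin t at fixed t, reaches polar
    coordinates with one-dimensional substitutions: the weights y / sin^2 t and sin t multiply
    to r. The absolute value keeps the weight nonnegative on the whole line. *)
Lemma half_plane_polar (R : realType) (f : R * R -> \bar R) : ge0_mfun f ->
  (\int[lebesgue1]_y ((\int[lebesgue1]_x f (x, y)) * (\1_pos_itv y)%:E) =
   \int[lebesgue1]_r \int[lebesgue1]_t
     (f (r * cos t, r * sin t)%R * (`|r| * \1_pos_itv r * \1_pi_itv t)%:E))%E.
Proof.
move=> nf.
have mn : measurable_fun setT (@ncot R) by rewrite /ncot; mfun.
transitivity (\int[lebesgue1]_y \int[lebesgue1]_t
    (f (- y * ncot t, y)%R *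
       (`|y| * (sin t) ^- 2 * \1_pi_itv t * \1_pos_itv y)%:E))%E.
  apply: eq_integral => y _.
  have [y0|y0] := ltP 0 y; last first.
    rewrite indic_npos// mule0 integral0_eq// => t _.
    by rewrite mulr0 mule0.
  rewrite indic_pos// mule1.
  rewrite -(@substitution_affine R (- y) 0 (fun x => f (x, y))); first last.
  - by ge0mfun.
  - by rewrite oppr_eq0 gt_eqF.
  rewrite -substitution_ncot; last by ge0mfun.
  apply: eq_integral => t _.
  by rewrite normrN addr0 -muleA -EFinM mulr1 mulrA.
rewrite integral_swap; last by ge0mfun.
rewrite [RHS]integral_swap; last by ge0mfun.
apply: eq_integral => t _.
have [[st ->]|->] := indic_pi_cases t; last first.
  by rewrite !integral0_eq// => x _; rewrite ?mulr0 ?mul0r mule0.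
rewrite -(@substitution_affine R (sin t) 0); first last.
- by ge0mfun.
- by rewrite gt_eqF.
apply: eq_integral => r _.
rewrite addr0 -muleA -EFinM; congr (f (_, _) * (_)%:E)%E.
- by rewrite /ncot; field; rewrite gt_eqF.
- by rewrite mulrC.
- have [r0|r0] := ltP 0 r.
    rewrite !indic_pos// ?mulr_gt0// !mulr1 normrM (gtr0_norm st); field.
    by rewrite gt_eqF.
  by rewrite !indic_npos ?mulr0 ?mul0r// pmulr_rle0.
Qed.

Lemma integral_reflect (R : realType) (f : R -> \bar R) : ge0_mfun f ->
  (\int[lebesgue1]_x f (- x)%R = \int[lebesgue1]_x f x)%E.
Proof.
move=> nf; rewrite -[RHS](@substitution_affine R (-1) 0)//.
by apply: eq_integral => x _; rewrite addr0 mulN1r normrN1 mule1.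
Qed.

Lemma integral_translate (R : realType) (c : R) (f : R -> \bar R) : ge0_mfun f ->
  (\int[lebesgue1]_x f (x + c)%R = \int[lebesgue1]_x f x)%E.
Proof.
move=> nf; rewrite -[RHS](@substitution_affine R 1 c)//.
by apply: eq_integral => x _; rewrite mul1r normr1 mule1.
Qed.

Lemma integral_itv_ends (R : realType) (x y : R) (b0 b1 : bool)
    (f : R -> \bar R) : ge0_mfun f ->
  (\int[lebesgue1]_(z in [set` Interval (BSide b0 x) (BSide b1 y)]) f z =
   \int[lebesgue1]_(z in `]x, y[) f z)%E.
Proof.
move=> nf; have [mf f0] := nf.
rewrite !integral_lebesgue1//; try by apply: measurable_funTS.
by rewrite integral_itv_bndoo//; apply: measurable_funTS.
Qed.

Lemma integral_split_sign (R : realType) (f : R -> \bar R) : ge0_mfun f ->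
  (\int[lebesgue1]_x f x =
   \int[lebesgue1]_x (f x * (\1_pos_itv x)%:E) +
   \int[lebesgue1]_x (f (- x)%R * (\1_pos_itv x)%:E))%E.
Proof.
move=> nf; have [mf f0] := nf.
have m0 : measurable (`[0, +oo[%classic : set R) by [].
have -> : (\int[lebesgue1]_x (f (- x)%R * (\1_pos_itv x)%:E) =
    \int[lebesgue1]_x (f x * (\1_(`[0%R, +oo[%classic) (- x)%R)%:E))%E.
  transitivity (\int[lebesgue1]_x (f (- x)%R * (\1_(`[0%R, +oo[%classic) x)%:E))%E.
    rewrite -!integral_mkindic !integral_lebesgue1//; try by [apply: measurable_funTS; mfun|nneg].
    by rewrite integral_itv_obnd_cbnd//; apply: measurable_funTS; mfun.
  rewrite -[LHS]integral_reflect; last by ge0mfun.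
  by apply: eq_integral => x _; rewrite opprK.
rewrite -ge0_integralD//; try by [mfun|nneg].
apply: eq_integral => x _; rewrite -ge0_muleDr ?lee_fin ?indic_ge0//.
rewrite -EFinD !indicE !mem_setE !in_itv/= !andbT oppr_ge0.
by case: ltP => _; rewrite ?addr0 ?add0r mule1.
Qed.

(** The upper half-plane accounts for angles in ]0, pi[ and the lower one, its image under
    the symmetry about the origin, for angles in ]pi, 2 pi[; the remaining angles and the
    axis y = 0 are negligible. *)
Lemma plane_polar (R : realType) (f : R * R -> \bar R) : ge0_mfun f ->
  (\int[lebesgue1]_x \int[lebesgue1]_y f (x, y) =
   \int[lebesgue1]_r \int[lebesgue1]_t
     (f (r * cos t, r * sin t)%R *
        (`|r| * \1_pos_itv r * \1_(`[0%R, (2 * pi)%R]%classic) t)%:E))%E.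
Proof.
move=> nf.
rewrite integral_swap; last by ge0mfun.
rewrite [LHS]integral_split_sign; last by ge0mfun.
rewrite (half_plane_polar nf).
have -> : (\int[lebesgue1]_y
    ((\int[lebesgue1]_x f (x, - y)%R) * (\1_pos_itv y)%:E) =
    \int[lebesgue1]_y
    ((\int[lebesgue1]_x f (- x, - y)%R) * (\1_pos_itv y)%:E))%E.
  apply: eq_integral => y _; congr (_ * _)%E.
  by rewrite -[LHS]integral_reflect//; ge0mfun.
have nf' : ge0_mfun (fun z : R * R => f (- z.1, - z.2)) by ge0mfun.
rewrite (half_plane_polar nf') -ge0_integralD//; try by [mfun|nneg].
apply: eq_integral => r _.
pose h t := (f (r * cos t, r * sin t)%R * (`|r| * \1_pos_itv r)%:E)%E.
have nh : ge0_mfun h by rewrite /h; ge0mfun.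
transitivity (\int[lebesgue1]_(t in `]0%R, pi[) h t +
   \int[lebesgue1]_(t in `]0%R, pi[) h (t + pi)%R)%E.
  rewrite [in RHS]integral_mkindic [X in (_ = _ + X)%E]integral_mkindic.
  congr adde.
    apply: eq_integral => t _.
    by rewrite /h -muleA -EFinM.
  apply: eq_integral => t _.
  by rewrite /h -muleA -EFinM /= cosDpi sinDpi !mulrN.
have -> : (\int[lebesgue1]_(t in `]0%R, pi[) h (t + pi)%R =
           \int[lebesgue1]_(t in `]pi, (2 * pi)%R[) h t)%E.
  rewrite [LHS]integral_mkindic [RHS]integral_mkindic -[RHS](@integral_translate _ pi); last by ge0mfun.
  apply: eq_integral => t _; congr (_ * _%:E)%E.
  rewrite !indicE !mem_setE !in_itv/=; congr (nat_of_bool _)%:R.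
  by apply/idP/idP; lra.
rewrite -(integral_itv_ends _ _ true true nh).
rewrite -(integral_itv_ends _ _ true false nh).
have [mh h0] := nh.
have p0 := pi_ge0 R.
have E : [set` Interval (BSide true 0) (BSide true pi)] `|`
    [set` Interval (BSide true pi) (BSide false (2 * pi))] = `[0, 2 * pi]%classic :> set R.
  apply/seteqP; split => t /=; rewrite !in_itv/=; first by move=> []/andP[]; lra.
  by case: (ltP t pi) => tp /andP[t1 t2]; [left|right]; apply/andP; split.
rewrite -ge0_integral_setU//=.
- rewrite E integral_mkindic; apply: eq_integral => t _.
  by rewrite /h -muleA -EFinM.
- exact: measurable_funTS.
- rewrite disj_set2E; apply/eqP/seteqP; split => // t [] /=.
  by rewrite !in_itv/= => /andP[_ t1] /andP[t2 _]; lra.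
Qed.

(** * Surface measure of spheres and polar coordinates in space *)

Definition turn_itv {R : realType} : set R := `[0, 2 * pi]%classic.

Lemma measurable_turn_itv (R : realType) : measurable (@turn_itv R).
Proof. exact: measurable_itv. Qed.

#[local] Hint Resolve measurable_turn_itv : core.

(** Density of the polar angle on the unit sphere, extended by 0 outside ]0, pi[. *)
Definition sinw {R : realType} (t : R) := sin t * \1_pi_itv t.

Lemma sinw_ge0 (R : realType) (t : R) : 0 <= sinw t.
Proof.
by rewrite /sinw; have [[/ltW s0 ->]|->] := indic_pi_cases t; rewrite ?mulr1 ?mulr0.
Qed.

Ltac nneg_hook ::= exact: sinw_ge0.

Lemma measurable_sinw (R : realType) : measurable_fun setT (@sinw R).
Proof. by rewrite /sinw; mfun. Qed.

Lemma measurable_angles (R : realType) : measurable (@angles R).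
Proof. exact: measurableX. Qed.

Section sphere_integral.
Context {R : realType}.
Implicit Type f : R3 R -> \bar R.

Let w (r : R) (u : R * R) := r ^+ 2 * sin u.1 * \1_angles u.

Let mw r : measurable_fun setT (w r).
Proof. by have ma := @measurable_angles R; rewrite /w; mfun. Qed.

Let w0 r u : 0 <= w r u.
Proof.
rewrite /w indicE; have [/set_mem [+ _]|_] := boolP (u \in _); last by rewrite mulr0.
by rewrite /= in_itv/= mulr1 => ?; rewrite mulr_ge0 ?sqr_ge0 ?sin_ge0_pi.
Qed.

(** By definition the surface measure is the image under spherical coordinates of a measure
    with a density. *)
Lemma sphere_integral_angles r f : ge0_mfun f ->
  (\int[sphere_measure r]_h f h =
   \int[lebesgue1 \x lebesgue1]_u (f (spherical r u) * (w r u)%:E))%E.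
Proof.
move=> nf; have ms := measurable_spherical r.
rewrite -(integral_weighted _ (mw r) (w0 r)); last by ge0mfun.
rewrite -(integral_pushm _ ms nf).
apply: eq_measure_integral => A mA _.
have ma := @measurable_angles R.
have mp : measurable (spherical r @^-1` A).
  by rewrite -[X in measurable X]setTI; exact: ms.
transitivity (weighted (lebesgue1 \x lebesgue1)%E (mw r) (w0 r) (spherical r @^-1` A)) => //.
rewrite weightedE /= /sphere_measure [LHS]integral_mkindic [RHS]integral_mkindic.
apply: eq_integral => u _; rewrite -!EFinM; congr EFin.
by rewrite indicI /w /= mulrA.
Qed.

Lemma sphere_integral r f : ge0_mfun f ->
  (\int[sphere_measure r]_h f h =
   \int[lebesgue1]_t \int[lebesgue1]_p (f (spherical r (t, p)) *
     (r ^+ 2 * (sinw t * \1_turn_itv p))%:E))%E.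
Proof.
move=> nf; rewrite sphere_integral_angles//.
have ms := measurable_spherical r; have := mw r => mwr.
transitivity (\int[lebesgue1 \x lebesgue1]_z
  (f (spherical r (z.1, z.2)) * (w r (z.1, z.2))%:E))%E.
  by apply: eq_integral => -[].
rewrite (integral_prod _ _ (F := fun t p => (f (spherical r (t, p)) * (w r (t, p))%:E)%E)); last by ge0mfun.
apply: eq_integral => t _; apply: eq_integral => p _; congr (_ * _%:E)%E.
rewrite /w /= -mulrA; congr (_ * _).
have -> : \1_angles (t, p) = \1_(`[0, pi]%classic) t * \1_turn_itv p :> R.
  rewrite !indicE -natrM mulnb; congr (nat_of_bool _)%:R.
  by rewrite in_setX.
rewrite mulrA /sinw; congr (_ * _); rewrite !indicE !mem_setE !in_itv/=.
have [->|t0] := eqVneq t 0; first by rewrite sin0 !mul0r.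
have [->|tpi] := eqVneq t pi; first by rewrite sinpi !mul0r.
by rewrite !lt_neqAle tpi (eq_sym 0) t0.
Qed.

End sphere_integral.

Definition scale3 {R : realType} (s : R) (h : R3 R) : R3 R :=
  (s * h.1.1, s * h.1.2, s * h.2).

Lemma mfun_scale3 d (T : measurableType d) (R : realType) (s : T -> R) (h : T -> R3 R) :
  measurable_fun setT s -> measurable_fun setT h ->
  measurable_fun setT (fun x => scale3 (s x) (h x)).
Proof. by move=> ms mh; rewrite /scale3; mfun. Qed.

Lemma sphere_scale (R : realType) (r : R) (f : R3 R -> \bar R) : ge0_mfun f ->
  (\int[sphere_measure r]_h f h =
   (\int[sphere_measure 1]_h f (scale3 r h)) * (r ^+ 2)%:E)%E.
Proof.
move=> nf.
have ms : measurable_fun setT (scale3 r) by apply: mfun_scale3; mfun.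
have m1 := measurable_spherical (1 : R).
have nfs : ge0_mfun (fun h => f (scale3 r h)) by ge0mfun.
have msw := @measurable_sinw R.
rewrite !sphere_integral//.
rewrite -ge0_mfun_integralZr; [|by ge0mfun|by nneg].
apply: eq_integral => t _.
rewrite -ge0_mfun_integralZr; [|by ge0mfun|by nneg].
apply: eq_integral => p _.
by rewrite -muleA -EFinM /scale3 /spherical /=; congr (f (_, _, _) * _%:E)%E; ring.
Qed.

(** Tonelli's theorem on (R * R) * R asks for a sigma-finite structure on the area measure
    of R * R. *)
Section plane_measure.
Context {R : realType}.

Definition lebesgue2 : set (R * R) -> \bar R := (@lebesgue1 R \x @lebesgue1 R)%E.

HB.instance Definition _ := Measure.on lebesgue2.

Let lebesgue2_sigma_finite : sigma_finite setT lebesgue2.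
Proof.
pose I (n : nat) : set R := `[- n%:R, n%:R]%classic.
have cover (x : R) n : ((Num.truncn `|x|).+1 <= n)%N -> I n x.
  move=> xn; rewrite /I /= in_itv/= -ler_norml (le_trans (ltW (truncnS_gt _)))//.
  by rewrite ler_nat.
have mI n : measurable (I n) by exact: measurable_itv.
exists (fun n => I n `*` I n).
  apply/seteqP; split => // -[x y] _.
  exists (maxn (Num.truncn `|x|).+1 (Num.truncn `|y|).+1) => //.
  by split; apply: cover => /=; rewrite leq_max leqnn ?orbT.
move=> n; split; first exact: measurableX.
rewrite [X in (X < _)%E](@product_measure1E _ _ _ _ _ lebesgue1 lebesgue1)//.
have nn : - n%:R <= n%:R :> R by have := ler0n R n; lra.
have lI : lebesgue1 (I n) = (n%:R - - n%:R)%:E := lebesgue1_itv true false nn.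
have lII : (lebesgue1 (I n) * lebesgue1 (I n) =
    ((n%:R - - n%:R) * (n%:R - - n%:R))%:E)%E by rewrite lI -EFinM.
by rewrite [X in (X < _)%E]lII ltry.
Qed.

HB.instance Definition _ := Measure_isSigmaFinite.Build _ _ _ lebesgue2
  lebesgue2_sigma_finite.

End plane_measure.

Lemma lebesgue3_iterated (R : realType) (f : R3 R -> \bar R) : ge0_mfun f ->
  (\int[lebesgue3]_h f h =
   \int[lebesgue1]_x \int[lebesgue1]_y \int[lebesgue1]_z f ((x, y), z))%E.
Proof.
move=> nf.
have E1 : (\int[lebesgue3]_h f h =
    \int[lebesgue1 \x lebesgue1]_p \int[lebesgue1]_z f (p, z))%E.
  rewrite -(@integral_prod _ _ _ _ _ (@lebesgue2 R) lebesgue1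
    (fun p z => f (p, z))); last by ge0mfun.
  by apply: eq_integral => -[].
have E2 : (\int[lebesgue1 \x lebesgue1]_p \int[lebesgue1]_z f (p, z) =
    \int[lebesgue1]_x \int[lebesgue1]_y \int[lebesgue1]_z f ((x, y), z))%E.
  rewrite -(@integral_prod _ _ _ _ _ lebesgue1 lebesgue1
    (fun x y => (\int[lebesgue1]_z f ((x, y), z))%E)); last by ge0mfun.
  by apply: eq_integral => -[].
by rewrite E1 E2.
Qed.

(** Polar coordinates (s, p) for the first two coordinates of the point, then polar
    coordinates (r, t) in the half-plane of the points (z, s) with s > 0: the two weights s and r
    give s r = r^2 sin t. *)
Lemma space_polar (R : realType) (f : R3 R -> \bar R) : ge0_mfun f ->
  (\int[lebesgue3]_h f h =
   \int[lebesgue1]_r ((\int[sphere_measure r]_h f h) * (\1_pos_itv r)%:E))%E.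
Proof.
move=> nf; have msw := @measurable_sinw R.
rewrite lebesgue3_iterated//.
have np : ge0_mfun (fun p => \int[lebesgue1]_z f ((p.1, p.2), z))%E by ge0mfun.
rewrite [LHS](plane_polar np).
rewrite integral_swap; last by ge0mfun.
transitivity (\int[lebesgue1]_p ((\int[lebesgue1]_r \int[lebesgue1]_t
   (f (spherical r (t, p)) * (`|r * sin t|)%:E *
     (`|r| * \1_pos_itv r * \1_pi_itv t)%:E)) * (\1_turn_itv p)%:E))%E.
  apply: eq_integral => p _.
  have nh : ge0_mfun (fun u : R * R =>
    f ((u.2 * cos p, u.2 * sin p), u.1)%R * (`|u.2|)%:E)%E by ge0mfun.
  rewrite -(half_plane_polar nh).
  rewrite -ge0_mfun_integralZr; [|by ge0mfun|by nneg].
  apply: eq_integral => s _ /=.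
  rewrite [in RHS]ge0_mfun_integralZr; [|by ge0mfun|by nneg].
  by rewrite -!muleA -!EFinM mulrA.
pose K r t p : \bar R := (f (spherical r (t, p)) *
  (r ^+ 2 * (sinw t * \1_turn_itv p) * \1_pos_itv r)%:E)%E.
have nK : ge0_mfun (fun z : R * R * R => K z.1.1 z.1.2 z.2) by rewrite /K /spherical /=; ge0mfun.
have nK' (r : R) : ge0_mfun (fun z : R * R => K r z.1 z.2) by rewrite /K /spherical /=; ge0mfun.
have nKs (r : R) : ge0_mfun (fun z : R * R => K r z.2 z.1) by rewrite /K /spherical /=; ge0mfun.
transitivity (\int[lebesgue1]_p \int[lebesgue1]_r \int[lebesgue1]_t K r t p)%E.
  apply: eq_integral => p _.
  rewrite -ge0_mfun_integralZr; [|by rewrite /spherical /=; ge0mfun|by nneg].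
  apply: eq_integral => r _.
  rewrite -ge0_mfun_integralZr; [|by rewrite /spherical /=; ge0mfun|by nneg].
  apply: eq_integral => t _.
  rewrite -!muleA -!EFinM; congr (_ * _%:E)%E; rewrite /sinw.
  have [[st ->]|->] := indic_pi_cases t; last by rewrite !(mulr0, mul0r).
  by rewrite normrM (gtr0_norm st) -real_normK ?num_real//; ring.
rewrite integral_swap; last first.
  have -> : (fun z : R * R => \int[lebesgue1]_t K z.2 t z.1)%E =
            (fun z : R * R => \int[lebesgue1]_t (fun u : R * R * R => K u.1.2 u.2 u.1.1) (z, t))%E by [].
  by rewrite /K /spherical /=; ge0mfun.
apply: eq_integral => r _.
rewrite integral_swap//.
rewrite sphere_integral// -ge0_mfun_integralZr; [|by rewrite /spherical /=; ge0mfun|by nneg].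
apply: eq_integral => t _.
rewrite -ge0_mfun_integralZr; [|by rewrite /spherical /=; ge0mfun|by nneg].
by apply: eq_integral => p _; rewrite -muleA.
Qed.

(** * Invariance of volume and surface measure under reflections *)

Definition dot3 {R : realType} (g h : R3 R) : R :=
  g.1.1 * h.1.1 + g.1.2 * h.1.2 + g.2 * h.2.

(** For a unit vector g, the orthogonal reflection in the plane normal to g. *)
Definition refl3 {R : realType} (g h : R3 R) : R3 R :=
  (h.1.1 - 2 * dot3 g h * g.1.1, h.1.2 - 2 * dot3 g h * g.1.2,
   h.2 - 2 * dot3 g h * g.2).

Lemma mfun_dot3 d (T : measurableType d) (R : realType) (g h : T -> R3 R) :
  measurable_fun setT g -> measurable_fun setT h ->
  measurable_fun setT (fun x => dot3 (g x) (h x)).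
Proof. by move=> mg mh; rewrite /dot3; mfun. Qed.

Lemma mfun_refl3 d (T : measurableType d) (R : realType) (g h : T -> R3 R) :
  measurable_fun setT g -> measurable_fun setT h ->
  measurable_fun setT (fun x => refl3 (g x) (h x)).
Proof. by move=> mg mh; rewrite /refl3 /dot3; mfun. Qed.

Lemma mfun_norm3 d (T : measurableType d) (R : realType) (h : T -> R3 R) :
  measurable_fun setT h -> measurable_fun setT (fun x => norm3 (h x)).
Proof. by move=> mh; rewrite /norm3; mfun. Qed.

(** Replacing the third coordinate by u = a x + b y + c z turns the reflection into a
    translation of (x, y) by a vector that depends only on u, together with the change of u
    into - u. Each of these preserves Lebesgue measure. *)
Section reflection_invariance.
Context {R : realType} (a b c : R).
Hypotheses (abc : a ^+ 2 + b ^+ 2 + c ^+ 2 = 1) (c0 : c != 0).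

Let Q (f : R3 R -> \bar R) (u x y : R) : \bar R :=
  (f ((x, y), (u - a * x - b * y) / c)%R * (`|c^-1|)%:E)%E.

Let slice (f : R3 R -> \bar R) : ge0_mfun f ->
  (\int[lebesgue3]_h f h =
   \int[lebesgue1]_u \int[lebesgue1]_x \int[lebesgue1]_y Q f u x y)%E.
Proof.
move=> nf; apply: (eq_trans (lebesgue3_iterated nf)).
transitivity (\int[lebesgue1]_x \int[lebesgue1]_y \int[lebesgue1]_u Q f u x y)%E.
  apply: eq_integral => x _; apply: eq_integral => y _.
  rewrite -(@substitution_affine R c^-1 (- (a * x + b * y) / c) (fun z => f ((x, y), z))).
  - apply: eq_integral => u _; rewrite /Q.
    by congr (f (_, _) * _)%E; ring.
  - by rewrite invr_neq0.
  - by ge0mfun.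
transitivity (\int[lebesgue1]_x \int[lebesgue1]_u \int[lebesgue1]_y Q f u x y)%E.
  apply: eq_integral => x _; apply: integral_swap; rewrite /Q.
  by ge0mfun.
apply: integral_swap.
have nQ : ge0_mfun (fun u : R * R * R => Q f u.1.2 u.1.1 u.2) by rewrite /Q; ge0mfun.
exact: (@ge0_mfun_integral _ _ _ _ _ lebesgue1 (fun z y => Q f z.2 z.1 y)).
Qed.

Lemma lebesgue3_refl (f : R3 R -> \bar R) : ge0_mfun f ->
  (\int[lebesgue3]_h f (refl3 ((a, b), c) h) = \int[lebesgue3]_h f h)%E.
Proof.
move=> nf.
have nfr : ge0_mfun (fun h => f (refl3 ((a, b), c) h)).
  split; last by nneg.
  apply: (@measurableT_comp _ _ _ _ _ _ f _ (refl3 (a, b, c))); first by mfun.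
  by apply: mfun_refl3; mfun.
apply: (eq_trans (slice nfr)); apply: (eq_trans _ (esym (slice nf))).
rewrite -[RHS]integral_reflect; last first.
  have nQ : ge0_mfun (fun u : R * R * R => Q f u.1.1 u.1.2 u.2) by rewrite /Q; ge0mfun.
  apply: (@ge0_mfun_integral _ _ _ _ _ lebesgue1 (fun u x => \int[lebesgue1]_y Q f u x y)%E).
  exact: (@ge0_mfun_integral _ _ _ _ _ lebesgue1 (fun z y => Q f z.1 z.2 y)).
apply: eq_integral => u _.
rewrite -[RHS](@integral_translate _ (- (2 * u * a))); last first.
  have nQ : ge0_mfun (fun v : R * R => Q f (- u) v.1 v.2) by rewrite /Q; ge0mfun.
  exact: (@ge0_mfun_integral _ _ _ _ _ lebesgue1 (fun x y => Q f (- u) x y)).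
apply: eq_integral => x _.
rewrite -[RHS](@integral_translate _ (- (2 * u * b))); last first.
  by rewrite /Q; ge0mfun.
apply: eq_integral => y _; rewrite /Q /refl3 /dot3 /=.
have cc : c ^+ 2 = 1 - a ^+ 2 - b ^+ 2 by rewrite -abc; ring.
have -> : a * x + b * y + c * ((u - a * x - b * y) / c) = u by field.
congr (f (_, _) * _)%E.
apply: (mulIf c0); rewrite mulfVK// mulrBl mulfVK// -!mulrA -expr2 cc; ring.
Qed.

End reflection_invariance.

Lemma lebesgue3_flip (R : realType) (f : R3 R -> \bar R) : ge0_mfun f ->
  (\int[lebesgue3]_h f ((- h.1.1, - h.1.2), h.2)%R = \int[lebesgue3]_h f h)%E.
Proof.
move=> nf.
have nff : ge0_mfun (fun h : R3 R => f ((- h.1.1, - h.1.2), h.2)) by ge0mfun.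
apply: (eq_trans (lebesgue3_iterated nff)).
apply: (eq_trans _ (esym (lebesgue3_iterated nf))).
rewrite -[RHS]integral_reflect; last by ge0mfun.
apply: eq_integral => x _.
by rewrite -[RHS]integral_reflect; last by ge0mfun.
Qed.

Lemma norm3_spherical (R : realType) (r : R) (u : R * R) :
  norm3 (spherical r u) = `|r|.
Proof.
rewrite /norm3 /spherical /= -sqrtr_sqr; congr Num.sqrt.
transitivity (r ^+ 2 * (sin u.1 ^+ 2 * (cos u.2 ^+ 2 + sin u.2 ^+ 2) + cos u.1 ^+ 2)).
  by ring.
by rewrite cos2Dsin2 mulr1 addrC cos2Dsin2 mulr1.
Qed.

Lemma norm3_ge0 (R : realType) (h : R3 R) : 0 <= norm3 h.
Proof. exact: sqrtr_ge0. Qed.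

Lemma sqr_norm3 (R : realType) (h : R3 R) : norm3 h ^+ 2 = dot3 h h.
Proof.
rewrite sqr_sqrtr; first by rewrite /dot3 -!expr2.
by rewrite !addr_ge0 ?sqr_ge0.
Qed.

Lemma norm3_scale (R : realType) (s : R) (h : R3 R) :
  norm3 (scale3 s h) = `|s| * norm3 h.
Proof.
rewrite /norm3 /scale3 /= -(sqrtr_sqr s) -sqrtrM ?sqr_ge0//; congr Num.sqrt.
by ring.
Qed.

Lemma scale3A (R : realType) (s t : R) (h : R3 R) :
  scale3 s (scale3 t h) = scale3 (s * t) h.
Proof. by rewrite /scale3/= !mulrA. Qed.

Lemma scale31 (R : realType) (h : R3 R) : scale3 1 h = h.
Proof. by case: h => -[x y] z; rewrite /scale3/= !mul1r. Qed.

Lemma norm3_eq0 (R : realType) (h : R3 R) : norm3 h = 0 -> h = 0.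
Proof.
move=> /(congr1 (fun x => x ^+ 2)); rewrite sqr_norm3 expr0n /dot3 -!expr2.
case: h => -[x y] z /= /eqP.
rewrite paddr_eq0 ?addr_ge0 ?sqr_ge0// paddr_eq0 ?sqr_ge0// !sqrf_eq0.
by move=> /andP[/andP[/eqP-> /eqP->] /eqP->].
Qed.

Lemma eq_sphere_integral (R : realType) (r : R) (f g : R3 R -> \bar R) :
  ge0_mfun f -> ge0_mfun g -> (forall h, norm3 h = `|r| -> f h = g h) ->
  (\int[sphere_measure r]_h f h = \int[sphere_measure r]_h g h)%E.
Proof.
move=> nf ng fg.
apply: (eq_trans (sphere_integral_angles r nf)).
apply: (eq_trans _ (esym (sphere_integral_angles r ng))).
by apply: eq_integral => u _; rewrite fg// norm3_spherical.
Qed.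

Definition unit_itv {R : realType} : set R := `]0, 1]%classic.

Lemma measurable_unit_itv (R : realType) : measurable (@unit_itv R).
Proof. exact: measurable_itv. Qed.

#[local] Hint Resolve measurable_unit_itv : core.

(** In polar coordinates the weight |h|^-2 compensates the growth of the spheres, so that
    all the radii in ]0, 1] contribute the same integral over the unit sphere. *)
Lemma cone_integral (R : realType) (f : R3 R -> \bar R) : ge0_mfun f ->
  (\int[sphere_measure 1]_h f h =
   \int[lebesgue3]_h (f (scale3 (norm3 h)^-1 h) *
     ((norm3 h) ^- 2 * \1_unit_itv (norm3 h))%:E))%E.
Proof.
move=> nf.
have mn : measurable_fun setT (@norm3 R) by apply: mfun_norm3; mfun.
have ms : measurable_fun setT (fun h : R3 R => scale3 (norm3 h)^-1 h).
  by apply: mfun_scale3; mfun.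
pose F (h : R3 R) := (f (scale3 (norm3 h)^-1 h) *
  ((norm3 h) ^- 2 * \1_unit_itv (norm3 h))%:E)%E.
have nF : ge0_mfun F.
  by rewrite /F; ge0mfun.
apply: (eq_trans _ (esym (space_polar nF))).
have mu := @measurable_unit_itv R.
have mg : measurable_fun setT (fun r : R => (\1_unit_itv r)%:E : \bar R) by mfun.
have [mf f0] := nf.
have s0 : (0 <= \int[sphere_measure 1]_h f h)%E by apply: integral_ge0.
transitivity (\int[lebesgue1]_r ((\int[sphere_measure 1]_h f h) * (\1_(@unit_itv R) r)%:E))%E.
  rewrite ge0_integralZl//.
  have -> : (\int[lebesgue1]_x (\1_(@unit_itv R) x)%:E = 1%:E)%E.
    rewrite integral_indic// setIT -[X in X%:E](subr0 1); exact: lebesgue1_itv.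
  by rewrite mule1.
apply: eq_integral => r _.
have [r0|r0] := ltP 0 r; last first.
  rewrite indic_npos// mule0 indicE mem_setE in_itv/= ltNge r0/=.
  by rewrite mule0.
rewrite indic_pos// mule1.
have mr : measurable_fun setT (scale3 r) by apply: mfun_scale3; mfun.
have nFr : ge0_mfun (fun h => F (scale3 r h)).
  split; last by move=> h; apply: (proj2 nF).
  exact: (measurableT_comp (proj1 nF) mr).
rewrite (sphere_scale _ nF).
transitivity ((\int[sphere_measure 1]_h (f h * (r ^- 2 * \1_unit_itv r)%:E)) * (r ^+ 2)%:E)%E.
  rewrite ge0_mfun_integralZr//; last by nneg.
  rewrite -muleA -EFinM; congr (_ * _%:E)%E.
  by rewrite mulrAC mulVf ?mul1r// expf_neq0// gt_eqF.
congr (_ * _)%E; apply: eq_sphere_integral => //; first by ge0mfun.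
move=> h; rewrite normr1 => h1.
by rewrite /F norm3_scale h1 mulr1 gtr0_norm// scale3A mulVf ?gt_eqF// scale31.
Qed.

Definition lin_isometry {R : realType} (g : R3 R -> R3 R) : Prop :=
  [/\ measurable_fun setT g,
      forall s h, g (scale3 s h) = scale3 s (g h),
      forall h, norm3 (g h) = norm3 h &
      forall f, ge0_mfun f ->
        (\int[lebesgue3]_h f (g h) = \int[lebesgue3]_h f h)%E].

(** A norm-preserving homogeneous map commutes with the radial projection, so that volume
    preservation passes to the unit sphere through [cone_integral]. *)
Lemma sphere_isometry (R : realType) (g : R3 R -> R3 R) (r : R)
    (f : R3 R -> \bar R) : lin_isometry g -> ge0_mfun f ->
  (\int[sphere_measure r]_h f (g h) = \int[sphere_measure r]_h f h)%E.
Proof.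
move=> [mg gs gn gl] nf.
have mr : measurable_fun setT (scale3 r) by apply: mfun_scale3; mfun.
have ngr : ge0_mfun (fun h => f (g h)) by ge0mfun.
have nfr : ge0_mfun (fun h => f (scale3 r h)) by ge0mfun.
have ngfr : ge0_mfun (fun h => f (scale3 r (g h))).
  by split; [exact: (measurableT_comp (proj1 nfr) mg)|nneg].
rewrite (sphere_scale _ ngr) (sphere_scale _ nf); congr (_ * _)%E.
rewrite (cone_integral nfr).
have mn : measurable_fun setT (@norm3 R) by apply: mfun_norm3; mfun.
have ms : measurable_fun setT (fun h : R3 R => scale3 (norm3 h)^-1 h).
  by apply: mfun_scale3; mfun.
rewrite -gl; last first.
  by ge0mfun.
transitivity (\int[sphere_measure 1]_h f (scale3 r (g h)))%E.
  by apply: eq_integral => h _; rewrite gs.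
rewrite (cone_integral ngfr); apply: eq_integral => h _.
by rewrite gn gs.
Qed.

Lemma lin_isometry_comp (R : realType) (g1 g2 : R3 R -> R3 R) :
  lin_isometry g1 -> lin_isometry g2 -> lin_isometry (g1 \o g2).
Proof.
move=> [m1 s1 n1 l1] [m2 s2 n2 l2]; split.
- exact: measurableT_comp.
- by move=> s h /=; rewrite s2 s1.
- by move=> h /=; rewrite n1 n2.
- move=> f nf; transitivity (\int[lebesgue3]_h f (g1 h))%E; last exact: l1.
  by apply: (l2 (fun h => f (g1 h))); ge0mfun.
Qed.

(** * Reflections *)

Section reflection_algebra.
Context {R : realType}.
Implicit Types g h k : R3 R.

Definition ez : R3 R := ((0, 0), 1).

Lemma eq_R3 h k : h.1.1 = k.1.1 -> h.1.2 = k.1.2 -> h.2 = k.2 -> h = k.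
Proof. by case: h k => -[? ?] ? [[? ?] ?] /= -> -> ->. Qed.

Lemma refl3_scale g s h : refl3 g (scale3 s h) = scale3 s (refl3 g h).
Proof. by apply: eq_R3; rewrite /refl3 /scale3 /dot3 /=; ring. Qed.

Lemma refl3D g h k : refl3 g (h + k) = refl3 g h + refl3 g k.
Proof. by apply: eq_R3; rewrite /refl3 /dot3 /=; ring. Qed.

Lemma dot3_refl g h k : dot3 (refl3 g h) k = dot3 h (refl3 g k).
Proof. by rewrite /refl3 /dot3 /=; ring. Qed.

Lemma dot3_refl_self g h : dot3 g g = 1 -> dot3 g (refl3 g h) = - dot3 g h.
Proof.
move=> g1; transitivity (dot3 g h - 2 * dot3 g h * dot3 g g).
  by rewrite /refl3 /dot3 /=; ring.
by rewrite g1; ring.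
Qed.

Lemma refl3K g h : dot3 g g = 1 -> refl3 g (refl3 g h) = h.
Proof.
move=> g1; rewrite {1}/refl3 dot3_refl_self//.
by apply: eq_R3; rewrite /refl3 /=; ring.
Qed.

Lemma norm3E h : norm3 h = Num.sqrt (dot3 h h).
Proof. by rewrite -sqr_norm3 sqrtr_sqr ger0_norm ?norm3_ge0. Qed.

Lemma norm3_refl g h : dot3 g g = 1 -> norm3 (refl3 g h) = norm3 h.
Proof. by move=> g1; rewrite !norm3E dot3_refl refl3K. Qed.

Lemma dot3_unit h : norm3 h = 1 -> dot3 h h = 1.
Proof. by move=> h1; rewrite -sqr_norm3 h1 expr1n. Qed.

Lemma refl3_refl w g h : dot3 w w = 1 ->
  refl3 (refl3 w g) h = refl3 w (refl3 g (refl3 w h)).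
Proof.
move=> w1.
have E (a b : R3 R) : refl3 a b = b - scale3 (2 * dot3 a b) a by [].
have L (k : R3 R) (c : R) : refl3 w (k - scale3 c g) = refl3 w k - scale3 c (refl3 w g).
  by apply: eq_R3; rewrite /refl3 /dot3 /scale3 /=; ring.
by rewrite (E g) L refl3K// E dot3_refl.
Qed.

(** The mirror is the bisecting plane of h and ez, with normal h - ez. *)
Lemma refl3_to_ez h : dot3 h h = 1 -> h <> ez ->
  exists w, [/\ dot3 w w = 1, w.2 != 0 & refl3 w h = ez].
Proof.
move=> h1 hez.
have h21 : h.2 < 1.
  rewrite lt_neqAle; apply/andP; split.
    apply/eqP => h2; apply: hez.
    have /eqP : h.1.1 ^+ 2 + h.1.2 ^+ 2 = 0.
      by move: h1; rewrite /dot3 h2; lra.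
    rewrite paddr_eq0 ?sqr_ge0// !sqrf_eq0 => /andP[/eqP x0 /eqP y0].
    exact: eq_R3.
  rewrite leNgt; apply/negP => h2; move: h1; rewrite /dot3.
  by have := sqr_ge0 h.1.1; have := sqr_ge0 h.1.2; nra.
pose n := Num.sqrt (2 - 2 * h.2).
have n2 : n ^+ 2 = 2 - 2 * h.2 by rewrite sqr_sqrtr//; lra.
have n0 : n != 0 by rewrite -sqrf_eq0 n2; apply/eqP; lra.
exists (scale3 n^-1 ((h.1.1, h.1.2), h.2 - 1)).
have ww : dot3 (scale3 n^-1 ((h.1.1, h.1.2), h.2 - 1))
               (scale3 n^-1 ((h.1.1, h.1.2), h.2 - 1)) = 1.
  transitivity ((dot3 h h + 1 - 2 * h.2) / n ^+ 2).
    by rewrite /dot3 /scale3 /=; field.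
  rewrite h1 n2; field; by apply/eqP; lra.
split => //.
  by rewrite /scale3 /= mulf_neq0 ?invr_neq0//; apply/eqP; lra.
have D : 2 * dot3 (scale3 n^-1 ((h.1.1, h.1.2), h.2 - 1)) h * n^-1 = 1.
  transitivity (2 * (dot3 h h - h.2) / n ^+ 2).
    by rewrite /dot3 /scale3 /=; field.
  rewrite h1 n2; field; by apply/eqP; lra.
have D' (x : R) : 2 * dot3 (scale3 n^-1 ((h.1.1, h.1.2), h.2 - 1)) h * (n^-1 * x) = x.
  by rewrite mulrA D mul1r.
by apply: eq_R3; rewrite /refl3 {2}/scale3 /= D'; ring.
Qed.

(** The change of coordinates behind [lebesgue3_refl] needs g.2 != 0. Otherwise the mirror is
    moved by a reflection that exchanges g and ez. *)
Lemma lin_isometry_refl g : dot3 g g = 1 -> lin_isometry (refl3 g).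
Proof.
have base (w : R3 R) : dot3 w w = 1 -> w.2 != 0 -> lin_isometry (refl3 w).
  move=> w1 w0; split.
  - by apply: mfun_refl3; mfun.
  - by move=> s h; rewrite refl3_scale.
  - by move=> h; exact: norm3_refl.
  - move=> f nf; case: w w1 w0 => -[a b] c /= w1 c0.
    by apply: lebesgue3_refl => //; rewrite -w1 /dot3 /=; ring.
move=> g1; have [g0|g0] := eqVneq g.2 0; last exact: base.
have [|w [w1 w0 wg]] := refl3_to_ez g1.
  by move=> /(congr1 snd) /=; rewrite g0 => /esym/eqP; rewrite oner_eq0.
have bw := base w w1 w0.
have be : lin_isometry (refl3 ez).
  by apply: base; rewrite /dot3 /= ?oner_neq0//; ring.
have -> : refl3 g = refl3 w \o (refl3 ez \o refl3 w).
  by apply/funext => h /=; rewrite -refl3_refl// -wg refl3K.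
exact: lin_isometry_comp bw (lin_isometry_comp be bw).
Qed.

Definition flip3 h : R3 R := ((- h.1.1, - h.1.2), h.2).

Lemma lin_isometry_flip : lin_isometry flip3.
Proof.
split.
- by rewrite /flip3; mfun.
- by move=> s h; apply: eq_R3; rewrite /flip3 /scale3 /=; ring.
- by move=> h; rewrite /norm3 /flip3 /= !sqrrN.
- by move=> f nf; exact: lebesgue3_flip.
Qed.

Lemma lin_isometry_opp : lin_isometry (fun h => - h).
Proof.
have -> : (fun h => - h) = flip3 \o refl3 ez.
  apply/funext => h; apply: eq_R3; rewrite /flip3 /refl3 /dot3 /=; ring.
apply: (lin_isometry_comp lin_isometry_flip); apply: lin_isometry_refl.
by rewrite /dot3 /=; ring.
Qed.

End reflection_algebra.

(** * Reflection invariant distributions *)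

Section reflected_point.
Context {R : realType}.
Implicit Type f : R3 R -> \bar R.

(** If g has polar angle t and azimuth p, then the reflected pole has polar angle 2 t - pi and
    azimuth p, and 2 |cos t| sin t = |sin (2 t - pi)|. As t runs over ]0, pi[ the angle 2 t - pi
    runs over ]- pi, pi[, each half of which covers the sphere once. *)
Lemma reflected_pole f : ge0_mfun f ->
  (\int[sphere_measure 1]_g (f (refl3 g ez) * (2 * `|g.2|)%:E) =
   \int[sphere_measure 1]_h f h)%E.
Proof.
move=> nf.
have msw := @measurable_sinw R; have ms := measurable_spherical (1 : R).
have mrz : measurable_fun setT (fun g : R3 R => refl3 g ez) by apply: mfun_refl3; mfun.
have nfr : ge0_mfun (fun g : R3 R => f (refl3 g ez) * (2 * `|g.2|)%:E)%E by ge0mfun.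
apply: (eq_trans (sphere_integral _ nfr)).
pose I : set R := `]- pi, pi[%classic.
have mI : measurable I by exact: measurable_itv.
(* The factor 1 / 2 makes up for the double cover, and |sin s| for the sign of sin s. *)
pose H (s : R) : \bar R := (\int[lebesgue1]_p
  (f (spherical 1 (s, p)) * (2^-1 * `|sin s| * \1_I s * \1_turn_itv p)%:E))%E.
have nH : ge0_mfun H by rewrite /H /spherical /=; ge0mfun.
transitivity (\int[lebesgue1]_t (H (2 * t - pi)%R * (`|2 : R|)%:E))%E.
  apply: eq_integral => t _.
  rewrite -ge0_mfun_integralZr; [|by rewrite /spherical /=; ge0mfun|by nneg].
  apply: eq_integral => p _.
  have t2 : 2 * t = t *+ 2 by rewrite mulr_natl.
  have s2 : sin (2 * t - pi) = - (2 * (sin t * cos t)).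
    by rewrite sinB cospi sinpi t2 sin_mulr2n; ring.
  have c2 : cos (2 * t - pi) = 1 - 2 * cos t ^+ 2.
    by rewrite cosB cospi sinpi t2 cos_mulr2n; ring.
  rewrite -!muleA -!EFinM; congr (f _ * _%:E)%E.
    apply: eq_R3; rewrite /refl3 /dot3 /spherical /= ?s2 ?c2; ring.
  have -> : \1_I (2 * t - pi) = \1_pi_itv t :> R.
    rewrite !indicE !mem_setE !in_itv/=; congr (nat_of_bool _)%:R.
    by apply/idP/idP; lra.
  rewrite s2 normrN /sinw /=.
  have [[st ->]|->] := indic_pi_cases t; last by rewrite !(mulr0, mul0r).
  rewrite !normrM (gtr0_norm st) !normr1 (ger0_norm (ler0n R 2)) expr1n; by field.
have n2 : (2 : R) != 0 by rewrite pnatr_eq0.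
apply: (eq_trans (substitution_affine (- pi) n2 nH)).
rewrite integral_split_sign//.
have half F : ge0_mfun F -> (\int[lebesgue1]_s
    ((\int[lebesgue1]_p (F (spherical 1 (s, p)) *
      (2^-1 * `|sin s| * \1_I s * \1_turn_itv p)%:E)) * (\1_pos_itv s)%:E) =
   (\int[sphere_measure 1]_h F h) * (2^-1)%:E)%E.
  move=> nF; rewrite (sphere_integral _ nF).
  rewrite -ge0_mfun_integralZr; [|by rewrite /spherical /=; ge0mfun|by nneg].
  apply: eq_integral => s _.
  rewrite -!ge0_mfun_integralZr; try by [rewrite /spherical /=; ge0mfun|nneg].
  apply: eq_integral => p _; rewrite -!muleA -!EFinM; congr (_ * _%:E)%E.
  have e : \1_I s * \1_pos_itv s = \1_pi_itv s :> R.
    rewrite !indicE !mem_setE !in_itv/= -natrM mulnb; congr (nat_of_bool _)%:R.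
    by have := pi_ge0 R => p0; apply/idP/idP; lra.
  transitivity (2^-1 * (`|sin s| * (\1_I s * \1_pos_itv s)) * \1_turn_itv p : R); first by ring.
  rewrite e /sinw expr1n mul1r.
  by have [[st ->]|->] := indic_pi_cases s; rewrite ?(gtr0_norm st); ring.
(* The direction of polar angle - s is that of polar angle s after half a turn about the axis. *)
have HN s : H (- s) = (\int[lebesgue1]_p (f (flip3 (spherical 1 (s, p))) *
      (2^-1 * `|sin s| * \1_I s * \1_turn_itv p)%:E))%E.
  apply: eq_integral => p _; congr (f _ * _%:E)%E.
    by apply: eq_R3; rewrite /flip3 /spherical /= ?sinN ?cosN; ring.
  rewrite sinN normrN; congr (_ * _ * _).
  rewrite !indicE !mem_setE !in_itv/=; congr (nat_of_bool _)%:R.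
  by apply/idP/idP; lra.
under [X in (_ + X)%E]eq_integral do rewrite HN.
have iso := @lin_isometry_flip R; have [mf3 _ _ _] := iso.
rewrite half// (half (fun h => f (flip3 h))); last by ge0mfun.
rewrite (sphere_isometry _ iso nf).
rewrite -ge0_muleDr ?lee_fin ?invr_ge0//.
by rewrite -EFinD (_ : 2^-1 + 2^-1 = 1) ?mule1//; lra.
Qed.

(** Conjugating by a reflection w that sends v to ez replaces g by its image under w, and the
    surface measure is invariant under w: this reduces v to the pole. *)
Lemma reflected_point f (v : R3 R) : ge0_mfun f -> dot3 v v = 1 ->
  (\int[sphere_measure 1]_g (f (refl3 g v) * (2 * `|dot3 g v|)%:E) =
   \int[sphere_measure 1]_h f h)%E.
Proof.
move=> nf v1.
have [->|vz] := pselect (v = ez).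
  apply: (eq_trans _ (reflected_pole nf)); apply: eq_integral => g _.
  by rewrite [dot3 g ez]/dot3 /ez /= !mulr0 !add0r mulr1.
have [w [w1 w0 wv]] := refl3_to_ez v1 vz.
have iso := lin_isometry_refl w1; have [mw _ _ _] := iso.
have mrv : measurable_fun setT (fun g : R3 R => refl3 g v) by apply: mfun_refl3; mfun.
have mdv : measurable_fun setT (fun g : R3 R => dot3 g v) by apply: mfun_dot3; mfun.
have nfw : ge0_mfun (fun h => f (refl3 w h)) by ge0mfun.
rewrite -(sphere_isometry _ iso); last by ge0mfun.
rewrite -[RHS](sphere_isometry _ iso nf) -(reflected_pole nfw).
apply: eq_integral => g _.
rewrite refl3_refl// dot3_refl wv.
by rewrite [dot3 g ez]/dot3 /ez /= !mulr0 !add0r mulr1.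
Qed.

End reflected_point.

Lemma ge0_mfun_swap d1 d2 (T1 : measurableType d1) (T2 : measurableType d2)
    (R : realType) (F : T1 -> T2 -> \bar R) :
  ge0_mfun (fun z : T1 * T2 => F z.1 z.2) -> ge0_mfun (fun z : T2 * T1 => F z.2 z.1).
Proof.
move=> [mF F0]; split; last by move=> z; exact: (F0 (z.2, z.1)).
have ms : measurable_fun setT (fun z : T2 * T1 => (z.2, z.1)) by mfun.
exact: measurableT_comp mF ms.
Qed.

Section radial.
Context {R : realType}.

(** This is 2 |<g, h / |h|>|, with the pole standing for h / |h| when h = 0. *)
Let W (g h : R3 R) : R :=
  2 * `|dot3 g h| * (norm3 h)^-1 + \1_[set 0 : R] (norm3 h) * (2 * `|g.2|).

(** Rescaled [reflected_point], in the direction of h. *)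
Lemma reflected_vector (f : R3 R -> \bar R) (h : R3 R) : ge0_mfun f ->
  (\int[sphere_measure 1]_g (f (refl3 g h) * (W g h)%:E) =
   \int[sphere_measure 1]_g f (scale3 (norm3 h) g))%E.
Proof.
move=> nf.
have [h0|h0] := eqVneq (norm3 h) 0.
  have hz := norm3_eq0 h0.
  transitivity (\int[sphere_measure 1]_g (f 0%R * (2 * `|g.2|)%:E))%E.
    apply: eq_integral => g _; congr (f _ * _%:E)%E.
      by rewrite hz; apply: eq_R3; rewrite /refl3 /dot3 /=; ring.
    by rewrite /W h0 invr0 mulr0 add0r indicE mem_set// mul1r.
  have nc : ge0_mfun (fun _ : R3 R => f 0%R) by ge0mfun.
  apply: (eq_trans (reflected_pole nc)); apply: eq_integral => g _; congr f.
  by rewrite h0; apply: eq_R3; rewrite /scale3 /= mul0r.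
have hp : 0 < norm3 h by rewrite lt_neqAle eq_sym h0 norm3_ge0.
have mr : measurable_fun setT (scale3 (norm3 h)) by apply: mfun_scale3; mfun.
have nfs : ge0_mfun (fun k => f (scale3 (norm3 h) k)) by ge0mfun.
set v := scale3 (norm3 h)^-1 h.
have v1 : dot3 v v = 1.
  by apply: dot3_unit; rewrite /v norm3_scale gtr0_norm ?invr_gt0// mulVf.
apply: (eq_trans _ (reflected_point nfs v1)); apply: eq_integral => g _.
congr (f _ * _%:E)%E.
  by rewrite -refl3_scale /v scale3A mulfV// scale31.
rewrite /W indicE memNset ?mul0r ?addr0; last by move=> /= /eqP; rewrite (negbTE h0).
have -> : dot3 g v = dot3 g h * (norm3 h)^-1 by rewrite /v /dot3 /scale3 /=; ring.
by rewrite normrM (gtr0_norm (x := (norm3 h)^-1)) ?invr_gt0// mulrA.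
Qed.

(** A random reflection with the law of [reflected_point] sends Z to a uniform point of the
    sphere of radius |Z|, while each single reflection leaves the law of Z unchanged. The
    weight takes the same value at h and at its reflection, so that both statements apply after
    exchanging the integrals over Z and over the normal of the mirror. *)
Lemma radial_average d (T : measurableType d) (m : {finite_measure set T -> \bar R})
    (Z : T -> R3 R) (f : R3 R -> \bar R) :
  measurable_fun setT Z -> ge0_mfun f ->
  (forall g, dot3 g g = 1 -> forall F, ge0_mfun F ->
    (\int[m]_x F (refl3 g (Z x)) = \int[m]_x F (Z x))%E) ->
  ((\int[m]_x f (Z x)) * sphere_measure (1 : R) setT =
   \int[m]_x \int[sphere_measure 1]_g f (scale3 (norm3 (Z x)) g))%E.
Proof.
move=> mZ nf inv.
have [mf f0] := nf.
have mn d' (T' : measurableType d') (h : T' -> R3 R) : measurable_fun setT h ->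
    measurable_fun setT (fun x => norm3 (h x)) by exact: mfun_norm3.
have mW d' (T' : measurableType d') (g h : T' -> R3 R) :
    measurable_fun setT g -> measurable_fun setT h ->
    measurable_fun setT (fun x => W (g x) (h x)).
  move=> mg mh; have := mn _ _ _ mh; have := mfun_dot3 mg mh => md mnh.
  by rewrite /W; mfun.
have W0 g h : 0 <= W g h.
  by rewrite /W; nneg; exact: norm3_ge0.
have mR d' (T' : measurableType d') (g h : T' -> R3 R) :
    measurable_fun setT g -> measurable_fun setT h ->
    measurable_fun setT (fun x => refl3 (g x) (h x)) by exact: mfun_refl3.
have one : ge0_mfun (fun _ : R3 R => 1%E : \bar R) by split; [mfun|].
have nfW : ge0_mfun (fun z : T * R3 R => f (Z z.1) * (W z.2 (Z z.1))%:E)%E.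
  have := mW _ _ (fun z : T * R3 R => z.2) (fun z => Z z.1).
  by move=> /(_ ltac:(mfun) ltac:(mfun)) mWz; ge0mfun.
have nrW : ge0_mfun (fun z : T * R3 R => f (refl3 z.2 (Z z.1)) * (W z.2 (Z z.1))%:E)%E.
  have := mW _ _ (fun z : T * R3 R => z.2) (fun z => Z z.1).
  move=> /(_ ltac:(mfun) ltac:(mfun)) mWz.
  have := mR _ _ (fun z : T * R3 R => z.2) (fun z => Z z.1).
  by move=> /(_ ltac:(mfun) ltac:(mfun)) mRz; ge0mfun.
transitivity (\int[m]_x \int[sphere_measure 1]_g (f (Z x) * (W g (Z x))%:E))%E.
  have mfZ : measurable_fun setT (fun x => f (Z x)) by mfun.
  have fZ0 x : setT x -> (0 <= f (Z x))%E by move=> _; exact: f0.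
  have s0 : (0 <= sphere_measure (1 : R) setT)%E by exact: measure_ge0.
  rewrite -ge0_integralZr//; apply: eq_integral => x _.
  have nW : ge0_mfun (fun g => (W g (Z x))%:E : \bar R).
    have := mW _ _ (fun g : R3 R => g) (fun=> Z x).
    by move=> /(_ ltac:(mfun) ltac:(mfun)) mWz; ge0mfun.
  have [mW1 W10] := nW.
  rewrite ge0_integralZl//.
  congr (_ * _)%E.
  transitivity (\int[sphere_measure 1]_g (1 : \bar R))%E.
    by rewrite integral_cst// mul1e.
  rewrite -(reflected_vector (Z x) one).
  by apply: eq_integral => g _; rewrite mul1e.
rewrite (@integral_swap _ _ _ _ _ m (sphere_measure 1)
  (fun x g => (f (Z x) * (W g (Z x))%:E)%E))//.
transitivity (\int[m]_x \int[sphere_measure 1]_g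
    (f (refl3 g (Z x)) * (W g (Z x))%:E))%E; last first.
  by apply: eq_integral => x _; exact: reflected_vector.
rewrite (@integral_swap _ _ _ _ _ m (sphere_measure 1)
  (fun x g => (f (refl3 g (Z x)) * (W g (Z x))%:E)%E))//.
apply: eq_sphere_integral.
- exact: ge0_mfun_integral (ge0_mfun_swap (F := fun x g => (f (Z x) * (W g (Z x))%:E)%E) nfW).
- exact: ge0_mfun_integral
    (ge0_mfun_swap (F := fun x g => (f (refl3 g (Z x)) * (W g (Z x))%:E)%E) nrW).
move=> g; rewrite normr1 => /dot3_unit g1.
have nF : ge0_mfun (fun h => f h * (W g h)%:E)%E.
  have := mW _ _ (fun=> g) (fun h : R3 R => h).
  by move=> /(_ ltac:(mfun) ltac:(mfun)) mWz; ge0mfun.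
rewrite -(inv g g1 _ nF); apply: eq_integral => x _; congr (_ * _%:E)%E.
by rewrite /W dot3_refl_self// normrN norm3_refl.
Qed.

End radial.

(** * The sum of two points of spheres *)

(** Archimedes: the height of a uniform point of the sphere is uniform on [-1, 1]. *)
Lemma integral_sinw (R : realType) (f : R -> \bar R) : ge0_mfun f ->
  (\int[lebesgue1]_t (f (- cos t)%R * (sinw t)%:E) =
   \int[lebesgue1]_(y in `[(-1)%R, 1%R]) f y)%E.
Proof.
move=> nf; have p0 := pi_gt0 R.
have c1 : - cos 0 = -1 :> R by rewrite cos0.
have c2 : - cos pi = 1 :> R by rewrite cospi opprK.
have mc : measurable_fun setT (fun t : R => - cos t) by mfun.
have msi : measurable_fun setT (@sin R) by mfun.
have -> : (\int[lebesgue1]_(y in `[(-1)%R, 1%R]) f y =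
    \int[lebesgue1]_(y in `[(- cos 0)%R, (- cos pi)%R]) f y)%E by rewrite c1 c2.
have dG (t : R) : 0 <= t <= pi -> is_derive t 1 (fun t => - cos t) (sin t).
  move=> _; have -> : (fun t : R => - cos t) = - cos by [].
  by apply: is_derive_eq; rewrite opprK.
have cs (t : R) : 0 <= t <= pi -> {for t, continuous sin}.
  by move=> _; exact: continuous_sin.
have s0 (t : R) : 0 <= t <= pi -> 0 <= sin t by exact: sin_ge0_pi.
have inc : {in `[0, pi] &, {homo (fun t : R => - cos t) : x y / x < y}}.
  by move=> x y xp yp xy; rewrite ltrN2 ltr_cos.
apply: (eq_trans _ (incr_substitution (ltW p0) mc msi dG cs s0 inc nf)).
apply: eq_integral => t _; congr (_ * _%:E)%E; rewrite /sinw !indicE !mem_setE !in_itv/=.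
have [->|t0] := eqVneq t 0; first by rewrite sin0 !mul0r.
have [->|tpi] := eqVneq t pi; first by rewrite sinpi !mul0r.
by rewrite !lt_neqAle tpi (eq_sym 0) t0.
Qed.

Lemma integral_turn_itv (R : realType) : (\int[lebesgue1]_p (\1_(@turn_itv R) p)%:E = (2 * pi)%:E)%E.
Proof.
have mt := @measurable_turn_itv R.
have p0 : 0 <= 2 * pi :> R by rewrite mulr_ge0// pi_ge0.
rewrite integral_indic// setIT -[X in X%:E](subr0 (2 * pi)).
exact: (lebesgue1_itv true false p0).
Qed.

Lemma sphere_setT (R : realType) (r : R) :
  sphere_measure r setT = (4 * pi * r ^+ 2)%:E.
Proof.
have one : ge0_mfun (fun _ : R3 R => 1%E : \bar R) by split; [mfun|].
have one1 : ge0_mfun (fun _ : R => 1%E : \bar R) by split; [mfun|].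
have msw := @measurable_sinw R.
transitivity (\int[sphere_measure r]_h (1 : \bar R))%E.
  by rewrite integral_cst// mul1e.
rewrite (sphere_scale _ one) (sphere_integral _ one).
rewrite (_ : 4 * pi * r ^+ 2 = 2 * (2 * pi) * r ^+ 2); last by ring.
rewrite [RHS]EFinM; congr (_ * _)%E.
transitivity (\int[lebesgue1]_t (1 * (sinw t)%:E * (2 * pi)%:E) : \bar R)%E.
  apply: eq_integral => t _.
  rewrite -integral_turn_itv mul1e -ge0_mfun_integralZl; [|by ge0mfun|by nneg].
  by apply: eq_integral => p _; rewrite mul1e -EFinM expr1n mul1r.
rewrite ge0_mfun_integralZr; [|by ge0mfun|by rewrite mulr_ge0// pi_ge0].
rewrite (integral_sinw one1) [RHS]EFinM; congr (_ * _)%E.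
have h : (-1 : R) <= 1 by lra.
rewrite integral_cst// mul1e; apply: (eq_trans (lebesgue1_itv true false h)).
by rewrite opprK.
Qed.

Section sphere_sum.
Context {R : realType} (r r' : R).
Hypotheses (r0 : 0 < r) (r'0 : 0 < r').

Let J : set R := `[`|r - r'|, r + r']%classic.

Let mJ : measurable J.
Proof. exact: measurable_itv. Qed.

Let J_ge0 x : J x -> 0 <= x.
Proof.
by rewrite /J /= in_itv/= => /andP[+ _]; apply: le_trans; exact: normr_ge0.
Qed.

(** The squared distance r^2 + r'^2 + 2 r r' cos t is an affine function of cos t, which is
    uniformly distributed; so it is uniform on [(r - r')^2, (r + r')^2], and the distance s itself
    has a density proportional to s. *)
Lemma distance_law (Phi : R -> \bar R) : ge0_mfun Phi ->
  (\int[sphere_measure r']_q Phi (norm3 (scale3 r ez + q)%R) =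
   \int[lebesgue1]_s (Phi s * (2 * pi * r' / r * s * \1_J s)%:E))%E.
Proof.
move=> nPhi; have msw := @measurable_sinw R; have p0 := pi_ge0 R.
have [/ltW rge0 /ltW r'ge0] := (r0, r'0).
have cpos : 0 <= pi * r' / r by nneg.
pose I : set R := `[(r - r') ^+ 2, (r + r') ^+ 2]%classic.
have mI : measurable I by exact: measurable_itv.
pose b := r ^+ 2 + r' ^+ 2; pose a := - (2 * r * r').
have a0 : a != 0 by rewrite oppr_eq0 !mulf_neq0 ?gt_eqF.
have na : `|a| = 2 * r * r' by rewrite normrN gtr0_norm// !mulr_gt0.
have nD : ge0_mfun (fun q : R3 R => Phi (norm3 (scale3 r ez + q))).
  have E : (fun q : R3 R => norm3 (scale3 r ez + q)) = (fun q : R3 R => norm3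
      ((r * 0 + q.1.1, r * 0 + q.1.2), r * 1 + q.2)) by [].
  have mE : measurable_fun setT (fun q : R3 R => norm3 (scale3 r ez + q)).
    by rewrite E; apply: mfun_norm3; mfun.
  by ge0mfun.
rewrite (sphere_integral _ nD).
transitivity (\int[lebesgue1]_t
    (Phi (Num.sqrt (a * (- cos t) + b)) * (2 * pi * r' ^+ 2)%:E * (sinw t)%:E))%E.
  apply: eq_integral => t _.
  have k0 : 0 <= r' ^+ 2 * sinw t by nneg.
  rewrite -!muleA -EFinM (_ : 2 * pi * r' ^+ 2 * sinw t = (r' ^+ 2 * sinw t) * (2 * pi));
    last by ring.
  rewrite EFinM -integral_turn_itv -ge0_mfun_integralZl; [|by ge0mfun|exact: k0].
  have [_ P0] := nPhi.
  rewrite -ge0_integralZl//; last 2 first.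
  - by mfun.
  - by move=> p _; nneg.
  apply: eq_integral => p _; rewrite -EFinM mulrA; congr (Phi _ * _)%E.
  rewrite /norm3; congr Num.sqrt; rewrite /spherical /scale3 /= /a /b.
  transitivity (r ^+ 2 + 2 * r * r' * cos t +
     r' ^+ 2 * (sin t ^+ 2 * (cos p ^+ 2 + sin p ^+ 2) + cos t ^+ 2)); first by ring.
  by rewrite cos2Dsin2 mulr1 (addrC (sin t ^+ 2)) cos2Dsin2; ring.
have n1 : ge0_mfun (fun y : R => Phi (Num.sqrt (a * y + b)) * (2 * pi * r' ^+ 2)%:E)%E by ge0mfun.
apply: (eq_trans (integral_sinw n1)).
have n2 : ge0_mfun (fun v : R => Phi (Num.sqrt v) * (\1_I v)%:E * (pi * r' / r)%:E)%E by ge0mfun.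
transitivity (\int[lebesgue1]_v (Phi (Num.sqrt v) * (\1_I v)%:E * (pi * r' / r)%:E))%E.
  apply: (eq_trans _ (substitution_affine b a0 n2)).
  rewrite [LHS]integral_mkindic; apply: eq_integral => y _.
  rewrite -!muleA -!EFinM; congr (_ * _%:E)%E; rewrite na.
  have -> : \1_I (a * y + b) = \1_(`[(-1), 1]%classic) y :> R.
    rewrite !indicE !mem_setE !in_itv/=; congr (nat_of_bool _)%:R.
    have rr : 0 < r * r' by rewrite mulr_gt0.
    by rewrite /a /b; apply/idP/idP => /andP[h1 h2]; apply/andP; split; nra.
  by field; rewrite gt_eqF.
have n3 : ge0_mfun (fun v : R => Phi (Num.sqrt v) * (pi * r' / r)%:E)%E by ge0mfun.
have mg : measurable_fun setT (fun s : R => 2 * s) by mfun.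
have mG : measurable_fun setT (fun s : R => s ^+ 2) by mfun.
have Jpq : `|r - r'| <= r + r' by rewrite ler_norml; apply/andP; split; lra.
transitivity (\int[lebesgue1]_(v in `[(`|r - r'| ^+ 2)%R, ((r + r') ^+ 2)%R])
    (Phi (Num.sqrt v) * (pi * r' / r)%:E))%E.
  rewrite real_normK ?num_real// [RHS]integral_mkindic.
  by apply: eq_integral => v _; rewrite muleAC.
have dG (s : R) : `|r - r'| <= s <= r + r' -> is_derive s 1 (fun s => s ^+ 2) (2 * s).
  move=> _; apply: is_derive_eq.
  by rewrite /GRing.scale/=; ring.
have cg (s : R) : `|r - r'| <= s <= r + r' -> {for s, continuous (fun s : R => 2 * s)}.
  by move=> _; apply: continuousM; [exact: cst_continuous|exact: cvg_id].
have g0 (s : R) : `|r - r'| <= s <= r + r' -> 0 <= 2 * s.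
  by move=> /andP[h _]; rewrite mulr_ge0// (le_trans _ h).
have inc : {in `[`|r - r'|, r + r'] &, {homo (fun s : R => s ^+ 2) : x y / x < y}}.
  move=> x y; rewrite !in_itv/= => /andP[h _] _ xy.
  have x0 : 0 <= x := le_trans (normr_ge0 _) h.
  by rewrite ltr_pXn2r ?nnegrE// (le_trans x0)// ltW.
apply: (eq_trans (esym (incr_substitution Jpq mG mg dG cg g0 inc n3))).
apply: eq_integral => s _; rewrite -/J.
rewrite sqrtr_sqr -!muleA -!EFinM.
have [/set_mem Js|nJs] := boolP (s \in J); last first.
  by rewrite indicE (negbTE nJs) !mulr0 !mule0.
rewrite ger0_norm; last exact: J_ge0.
by congr (_ * _%:E)%E; ring.
Qed.
End sphere_sum.

Lemma integral_fprod (R : realType) (r r' : R) (F : R3 R -> R3 R -> \bar R) :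
  ge0_mfun (fun z => F z.1 z.2) ->
  (\int[Defs.fprod (sphere_measure r) (sphere_measure r')]_z F z.1 z.2 =
   \int[sphere_measure r]_p \int[sphere_measure r']_q F p q)%E.
Proof.
by move=> nF; exact: (@integral_prod _ _ _ _ _ (sphere_measure r) (sphere_measure r') F nF).
Qed.

Lemma mfun_add3 d (T : measurableType d) (R : realType) (g h : T -> R3 R) :
  measurable_fun setT g -> measurable_fun setT h ->
  measurable_fun setT (fun x => g x + h x).
Proof.
move=> mg mh.
have mgh : measurable_fun setT (fun x => (g x, h x)) by mfun.
exact: (measurableT_comp (@measurable_add3 R) mgh).
Qed.

(** The law of p + q is invariant under reflections, hence the average of the uniform measures
    on the spheres of radii |p + q|. The distribution of the radius is given by [distance_law] and
    its density, divided by the weight of the spheres in polar coordinates, is that of p + q. *)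
Section sum_of_spheres.
Context {R : realType} (r r' : R).
Hypotheses (r0 : 0 < r) (r'0 : 0 < r').
Variable f : R3 R -> \bar R.
Hypothesis nf : ge0_mfun f.

Let m := Defs.fprod (sphere_measure r) (sphere_measure r').
Let mZ := @measurable_add3 R.

Let nZ (F : R3 R -> \bar R) : ge0_mfun F -> ge0_mfun (fun z : R3 R * R3 R => F (z.1 + z.2)).
Proof.
move=> nF; split; last by nneg.
exact: (measurableT_comp (proj1 nF) mZ).
Qed.

Let nZr (F : R3 R -> \bar R) (p : R3 R) : ge0_mfun F -> ge0_mfun (fun q => F (p + q)).
Proof.
move=> nF; split; last by nneg.
by apply: (measurableT_comp (proj1 nF)); apply: mfun_add3; mfun.
Qed.

Let sum_refl g : dot3 g g = 1 -> forall F, ge0_mfun F ->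
  (\int[m]_z F (refl3 g (add3 z)) = \int[m]_z F (add3 z))%E.
Proof.
move=> g1 F nF; rewrite /m /add3.
have iso := lin_isometry_refl g1; have [mg _ _ _] := iso.
have nFg : ge0_mfun (fun h => F (refl3 g h)) by ge0mfun.
rewrite (integral_fprod r r' (F := fun p q => F (refl3 g (p + q)))); last exact: (nZ nFg).
rewrite (integral_fprod r r' (F := fun p q => F (p + q))); last exact: (nZ nF).
rewrite -[RHS](sphere_isometry _ iso); last first.
  exact: (@ge0_mfun_integral _ _ _ _ _ (sphere_measure r') (fun p q : R3 R => F (p + q)) (nZ nF)).
apply: eq_integral => p _.
rewrite -[RHS](sphere_isometry _ iso); last exact: nZr.
by apply: eq_integral => q _; rewrite refl3D.
Qed.

Let Phi (s : R) : \bar R := (\int[sphere_measure 1]_g f (scale3 s g))%E.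

Let nPhi : ge0_mfun Phi.
Proof.
apply: (@ge0_mfun_integral _ _ _ _ _ (sphere_measure 1) (fun (s : R) (g : R3 R) => f (scale3 s g))).
have ms : measurable_fun setT (fun z : R * R3 R => scale3 z.1 z.2).
  by apply: mfun_scale3; mfun.
by ge0mfun.
Qed.

Let J : set R := `[`|r - r'|, r + r']%classic.

Let inner (p : R3 R) : norm3 p = `|r| ->
  (\int[sphere_measure r']_q Phi (norm3 (p + q)%R) =
   \int[lebesgue1]_s (Phi s * (2 * pi * r' / r * s * \1_J s)%:E))%E.
Proof.
move=> pr0; have pr : norm3 p = r by rewrite pr0; exact: gtr0_norm.
apply: (eq_trans _ (distance_law r0 r'0 nPhi)).
have mnorm : measurable_fun setT (@norm3 R) by apply: mfun_norm3; mfun.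
have nPn : ge0_mfun (fun h => Phi (norm3 h)) by ge0mfun.
pose v := scale3 r^-1 p.
have rK : r / r = 1 by rewrite mulfV// gt_eqF.
have pv : p = scale3 r v by rewrite /v scale3A rK scale31.
have v1 : dot3 v v = 1.
  apply: dot3_unit; rewrite /v norm3_scale pr gtr0_norm ?invr_gt0//.
  by rewrite mulrC rK.
have [vz|vz] := pselect (v = ez); first by rewrite pv vz.
have [w [w1 _ wv]] := refl3_to_ez v1 vz.
have iso := lin_isometry_refl w1.
rewrite -[RHS](sphere_isometry _ iso); last exact: (nZr _ nPn).
apply: eq_integral => q _.
by rewrite -wv -refl3_scale -refl3D norm3_refl// -pv.
Qed.

Lemma sphere_sum :
  (\int[m]_z f (add3 z) =
   \int[lebesgue3]_h
     (f h * (2 * pi * r * r' / norm3 h * \1_J (norm3 h))%:E))%E.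
Proof.
have [/ltW rge0 /ltW r'ge0] := (r0, r'0).
have p0 := pi_gt0 R; have p0' := ltW p0.
have mJ : measurable J by exact: measurable_itv.
have rad := radial_average mZ nf sum_refl.
have mnorm : measurable_fun setT (@norm3 R) by apply: mfun_norm3; mfun.
have nPn : ge0_mfun (fun h => Phi (norm3 h)) by ge0mfun.
have main : (\int[m]_z Phi (norm3 (add3 z)) =
    (\int[lebesgue1]_s (Phi s * (2 * pi * r' / r * s * \1_J s)%:E)) *
    (4 * pi * r ^+ 2)%:E)%E.
  rewrite /m /add3 (integral_fprod r r' (F := fun p q => Phi (norm3 (p + q)%R)));
    last exact: (nZ nPn).
  rewrite -sphere_setT.
  have [_ P0] := nPhi.
  have i0 : (0 <= \int[lebesgue1]_s (Phi s * (2 * pi * r' / r * s * \1_J s)%:E))%E.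
    apply: integral_ge0 => s _; rewrite mule_ge0// lee_fin.
    have [/set_mem|nJ] := boolP (s \in J); last by rewrite indicE (negbTE nJ) mulr0.
    rewrite /J /= in_itv/= => /andP[h _].
    have s0 : 0 <= s := le_trans (normr_ge0 _) h.
    by nneg.
  rewrite -integral_cst//; apply: eq_sphere_integral.
  - exact: (@ge0_mfun_integral _ _ _ _ _ (sphere_measure r') (fun p q : R3 R => Phi (norm3 (p + q))) (nZ nPn)).
  - by split; [mfun|].
  - exact: inner.
have sp : 0 < 4 * pi :> R by rewrite mulr_gt0.
rewrite main sphere_setT expr1n mulr1 in rad.
have c0 : (4 * pi : R) != 0 by rewrite gt_eqF.
(* Both sides of rad carry the total mass 4 pi of the unit sphere. *)
have cancel (x y : \bar R) : (x * (4 * pi)%:E = y * (4 * pi)%:E -> x = y)%E.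
  have K (z : \bar R) : (z * (4 * pi)%:E * ((4 * pi)^-1)%:E = z)%E.
    by rewrite -muleA -EFinM mulfV// mule1.
  by move=> xy; rewrite -(K x) xy K.
have J_ge0 s : J s -> 0 <= s.
  by rewrite /J /= in_itv/= => /andP[h _]; exact: le_trans (normr_ge0 _) h.
pose K (s : R) : R := 2 * pi * r * r' / s * \1_J s.
have K0 s : 0 <= K s.
  rewrite /K; have [/set_mem/J_ge0 s0|nJ] := boolP (s \in J); first by nneg.
  by rewrite indicE (negbTE nJ) mulr0.
have mK : measurable_fun setT K by rewrite /K; mfun.
have nF : ge0_mfun (fun h => f h * (K (norm3 h))%:E)%E by ge0mfun.
have nw : ge0_mfun (fun s => Phi s * (2 * pi * r' / r * s * \1_J s)%:E)%E.
  split; first by mfun.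
  move=> s; rewrite mule_ge0//; first by nneg.
  rewrite lee_fin; have [/set_mem/J_ge0 s0|nJ] := boolP (s \in J); first by nneg.
  by rewrite indicE (negbTE nJ) mulr0.
transitivity ((\int[lebesgue1]_s (Phi s * (2 * pi * r' / r * s * \1_J s)%:E)) *
   (r ^+ 2)%:E)%E.
  by apply: cancel; rewrite rad -muleA -EFinM [4 * pi * _]mulrC.
rewrite -ge0_mfun_integralZr//; last exact: sqr_ge0.
apply: (eq_trans _ (esym (space_polar nF))); apply: eq_integral => s _.
have [s0|s0] := ltP 0 s; last first.
  rewrite indic_npos// mule0 [X in (Phi s * X%:E)%E](_ : _ = 0) ?mule0 ?mul0e//.
  have [/set_mem/J_ge0 s0'|nJ] := boolP (s \in J); last by rewrite indicE (negbTE nJ) mulr0.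
  by rewrite (_ : s = 0) ?mulr0 ?mul0r//; lra.
rewrite indic_pos// mule1 (sphere_scale _ nF).
have ms : measurable_fun setT (scale3 s) by apply: mfun_scale3; mfun.
have nfs : ge0_mfun (fun g => f (scale3 s g)) by ge0mfun.
transitivity ((\int[sphere_measure 1]_g (f (scale3 s g) * (K s)%:E)) * (s ^+ 2)%:E)%E.
  rewrite ge0_mfun_integralZr// -!muleA -!EFinM; congr (_ * _%:E)%E.
  by rewrite /K; field; rewrite !gt_eqF.
congr (_ * _)%E; apply: eq_sphere_integral; [by ge0mfun| |].
  split; last by move=> g; apply: (proj2 nF).
  exact: (measurableT_comp (proj1 nF) ms).
move=> g; rewrite normr1 => g1; congr (_ * (K _)%:E)%E.
by rewrite norm3_scale g1 mulr1 gtr0_norm.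
Qed.

End sum_of_spheres.

(** * Multiples of positive measures as charges *)

(** For a multiple of a positive measure one of the Jordan parts vanishes: on the negative part
    of a Hahn decomposition, b m is nonpositive and has the sign of b. *)
Section jordan_scaled.
Context d (T : measurableType d) (R : realType).
Variables (nu : {charge set T -> \bar R}) (m : {measure set T -> \bar R}) (b : R).
Hypothesis nuE : forall A, measurable A -> nu A = (b%:E * m A)%E.

Let jordanE (P N : set T) (nuPN : hahn_decomposition nu P N) (A : set T) :
  measurable A ->
  jordan_pos nuPN A = ((Num.max b 0)%:E * m A)%E /\
  jordan_neg nuPN A = ((Num.max (- b) 0)%:E * m A)%E.
Proof.
move=> mA.
have [[mP posP] [mN negN] _ _] := nuPN.
have dec := jordan_decomp nuPN mA; rewrite /cadd /= cscaleN1 in dec.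
have mAP : measurable (A `&` P) by exact: measurableI.
have mAN : measurable (A `&` N) by exact: measurableI.
have posE : jordan_pos nuPN A = nu (A `&` P).
  by rewrite jordan_posE cjordan_posE /crestr0 mem_set.
have negE : jordan_neg nuPN A = (- nu (A `&` N))%E.
  by rewrite jordan_negE cjordan_negE /crestr0 mem_set.
have [b0|b0] := leP 0 b.
  have n0 : jordan_neg nuPN A = 0%E.
    apply/eqP; rewrite eq_le measure_ge0 andbT negE leeNl oppe0 nuE//.
    by rewrite mule_ge0 ?lee_fin.
  rewrite max_r ?oppr_le0// mul0e -nuE// dec; split => //.
  by rewrite [X in (_ - X)%E](_ : _ = 0%E) ?sube0.
have n0 : jordan_pos nuPN A = 0%E.
  apply/eqP; rewrite eq_le measure_ge0 andbT posE nuE//.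
  by rewrite mule_le0_ge0 ?lee_fin// ltW.
rewrite max_l ?oppr_ge0 ?(ltW b0)// mul0e EFinN mulNe -nuE// dec; split => //.
by rewrite [X in (- (X - _))%E](_ : _ = 0%E)// sub0e oppeK.
Qed.

Lemma jpos_scaled (A : set T) : measurable A ->
  jpos nu A = ((Num.max b 0)%:E * m A)%E.
Proof. by move=> mA; exact: (proj1 (jordanE _ mA)). Qed.

Lemma jneg_scaled (A : set T) : measurable A ->
  jneg nu A = ((Num.max (- b) 0)%:E * m A)%E.
Proof. by move=> mA; exact: (proj2 (jordanE _ mA)). Qed.

End jordan_scaled.

Lemma fprod_scaled d1 d2 (T1 : measurableType d1) (T2 : measurableType d2)
    (R : realType) (a b : R) (m1 n1 : {finite_measure set T1 -> \bar R})
    (m2 n2 : {finite_measure set T2 -> \bar R}) (S : set (T1 * T2)) :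
  0 <= a -> 0 <= b ->
  (forall A, measurable A -> m1 A = (a%:E * n1 A)%E) ->
  (forall A, measurable A -> m2 A = (b%:E * n2 A)%E) ->
  measurable S -> Defs.fprod m1 m2 S = ((a * b)%:E * Defs.fprod n1 n2 S)%E.
Proof.
move=> a0 b0 m1E m2E mS.
have mF : measurable_fun setT (n2 \o xsection S) by exact: measurable_fun_xsection.
have F0 x : setT x -> (0 <= (n2 \o xsection S) x)%E by [].
have mbF : measurable_fun setT (fun x => b%:E * (n2 \o xsection S) x)%E.
  by apply: emeasurable_funM.
transitivity (\int[m1]_x (b%:E * (n2 \o xsection S) x))%E.
  apply: eq_integral => x _ /=; rewrite m2E//; exact: measurable_xsection.
transitivity (\int[mscale (NngNum a0) n1]_x (b%:E * (n2 \o xsection S) x))%E.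
  by apply: eq_measure_integral => A mA _; exact: m1E.
rewrite ge0_integral_mscale//; last by move=> x _; rewrite mule_ge0// lee_fin.
by rewrite ge0_integralZl// muleA -EFinM.
Qed.

(** Bilinearity of the product, after decomposing a and b into positive and negative parts. *)
Lemma cprod_scaled d1 d2 (T1 : measurableType d1) (T2 : measurableType d2)
    (R : realType) (a b : R) (mu : {charge set T1 -> \bar R})
    (nu : {charge set T2 -> \bar R}) (m : {finite_measure set T1 -> \bar R})
    (n : {finite_measure set T2 -> \bar R}) (S : set (T1 * T2)) :
  (forall A, measurable A -> mu A = (a%:E * m A)%E) ->
  (forall A, measurable A -> nu A = (b%:E * n A)%E) ->
  measurable S -> cprod mu nu S = ((a * b)%:E * Defs.fprod m n S)%E.
Proof.
move=> muE nuE mS.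
have max0 (x : R) : 0 <= Num.max x 0 by rewrite le_max lexx orbT.
have pp := fprod_scaled (max0 a) (max0 b) (jpos_scaled muE) (jpos_scaled nuE) mS.
have nn := fprod_scaled (max0 (- a)) (max0 (- b)) (jneg_scaled muE) (jneg_scaled nuE) mS.
have pn := fprod_scaled (max0 a) (max0 (- b)) (jpos_scaled muE) (jneg_scaled nuE) mS.
have np := fprod_scaled (max0 (- a)) (max0 b) (jneg_scaled muE) (jpos_scaled nuE) mS.
transitivity ((Defs.fprod (jpos mu) (jpos nu) S + Defs.fprod (jneg mu) (jneg nu) S) -
   (Defs.fprod (jpos mu) (jneg nu) S + Defs.fprod (jneg mu) (jpos nu) S))%E => //.
rewrite pp nn pn np.
have : Defs.fprod m n S \is a fin_num by exact: fin_num_measure.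
case: (Defs.fprod m n S) => // x _; rewrite -!EFinM -!EFinD.
congr EFin.
have maxE (y : R) : Num.max y 0 - Num.max (- y) 0 = y.
  have [y0|/ltW y0] := leP 0 y; first by rewrite max_r ?oppr_le0// subr0.
  by rewrite max_l ?oppr_ge0// sub0r opprK.
rewrite -[in RHS](maxE a) -[in RHS](maxE b); ring.
Qed.

(** At t = 0 the coefficient is the inverse of 0, that is 0. *)
Lemma greenE (R : realType) (c t : R) (A : set (R3 R)) :
  green c t A = (((4 * pi * c ^+ 2 * t)^-1)%:E * sphere_measure (c * `|t|) A)%E.
Proof.
rewrite /green; case: eqP => [->|_] //=.
by rewrite mulr0 invr0 mul0e.
Qed.

(** * Measurability of continuous functions in space *)

(** An open set is the union of the cubes with rational centres and radii 1 / (n + 1) that it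
    contains. *)
Lemma open_measurable3 (R : realType) (O : set (R3 R)) : open O -> measurable O.
Proof.
move=> oO.
pose B (q : rat * rat * rat * nat) : set (R3 R) :=
  (ball (ratr q.1.1.1 : R) (q.2.+1%:R^-1) `*` ball (ratr q.1.1.2 : R) (q.2.+1%:R^-1))
  `*` ball (ratr q.1.2 : R) (q.2.+1%:R^-1).
have mB q : measurable (B q).
  by apply: measurableX; [apply: measurableX|]; exact: measurable_ball.
have -> : O = \bigcup_q (if `[< B q `<=` O >] then B q else set0).
  apply/seteqP; split; last first.
    by move=> x [q _]; case: asboolP => // + Bx; exact.
  move=> x Ox; have := open_nbhs_nbhs (conj oO Ox); rewrite -nbhs_ballE => -[e /= e0 eO].
  have [n n2] : exists n : nat, 2 * n.+1%:R^-1 < e.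
    exists (Num.truncn (2 / e)).
    rewrite ltr_pdivrMr ?ltr0n// mulrC -ltr_pdivrMr//; exact: truncnS_gt.
  have n0 : 0 < n.+1%:R^-1 :> R by rewrite invr_gt0 ltr0n.
  have near_rat (y : R) : exists p : rat, ball (ratr p : R) (n.+1%:R^-1) y.
    have [p] := @rat_in_itvoo R y (y + n.+1%:R^-1) ltac:(by rewrite ltrDl).
    rewrite in_itv/= => /andP[yp py]; exists p.
    by rewrite -ball_normE /ball_ /= ger0_norm ?subr_ge0 ?(ltW yp)// ltrBlDl.
  have [p1 h1] := near_rat x.1.1; have [p2 h2] := near_rat x.1.2.
  have [p3 h3] := near_rat x.2.
  exists ((p1, p2), p3, n) => //; rewrite asboolT; first by split.
  move=> y [[/= y1 y2] y3]; apply: eO.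
  have tri (p : rat) (u v : R) : ball (ratr p : R) (n.+1%:R^-1) u ->
      ball (ratr p : R) (n.+1%:R^-1) v -> ball u e v.
    move=> pu pv; apply: (@le_ball _ _ _ (n.+1%:R^-1 + n.+1%:R^-1)); first by move: n2; rewrite mulr_natl mulr2n; exact: ltW.
    exact: ball_triangle (ball_sym pu) pv.
  by split; [split|]; [exact: tri h1 y1|exact: tri h2 y2|exact: tri h3 y3].
apply: countable_bigcupT_measurable; first exact: countableP.
by move=> q; case: ifP.
Qed.

Lemma continuous_measurable3 (R : realType) (f : R3 R -> R) :
  continuous f -> measurable_fun setT f.
Proof.
move=> /continuousP cf; apply: (measurability _ (RGenOpens.measurableE R)) => //.
move=> _ [_ [a [b ->] <-]]; rewrite setTI; apply: open_measurable3.
by apply: cf; exact: interval_open.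
Qed.

(** * Convolution of Green's functions *)

(** Both integrals are determined by the image measures. The positive and negative parts of
    f are transported separately, so that f may fail to be integrable. *)
Lemma eq_integral_push d1 d2 d (T1 : measurableType d1) (T2 : measurableType d2)
    (T : measurableType d) (R : realType) (m1 : {measure set T1 -> \bar R})
    (m2 : {measure set T2 -> \bar R}) (Z1 : T1 -> T) (Z2 : T2 -> T)
    (f : T -> \bar R) :
  measurable_fun setT Z1 -> measurable_fun setT Z2 -> measurable_fun setT f ->
  (forall A, measurable A -> m1 (Z1 @^-1` A) = m2 (Z2 @^-1` A)) ->
  (\int[m1]_x f (Z1 x) = \int[m2]_x f (Z2 x))%E.
Proof.
move=> mZ1 mZ2 mf m12.
have H g : ge0_mfun g -> (\int[m1]_x g (Z1 x) = \int[m2]_x g (Z2 x))%E.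
  move=> ng; rewrite -(integral_pushm m1 mZ1 ng) -(integral_pushm m2 mZ2 ng).
  by apply: eq_measure_integral => A mA _; exact: m12.
have np : ge0_mfun (f^\+)%E by split; [exact: measurable_funepos|exact: funepos_ge0].
have nn : ge0_mfun (f^\-)%E by split; [exact: measurable_funeneg|exact: funeneg_ge0].
rewrite [LHS]integralE [RHS]integralE.
congr (_ - _)%E.
  by apply: (eq_trans _ (eq_trans (H _ np) _)); apply: eq_integral => x _; rewrite !funeposE.
by apply: (eq_trans _ (eq_trans (H _ nn) _)); apply: eq_integral => x _; rewrite !funenegE.
Qed.

(** The Jordan parts of the two charges are the same multiples of m1 and m2. *)
Lemma eq_cintegral_push d1 d2 d (T1 : measurableType d1) (T2 : measurableType d2)
    (T : measurableType d) (R : realType) (nu1 : {charge set T1 -> \bar R})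
    (nu2 : {charge set T2 -> \bar R}) (m1 : {measure set T1 -> \bar R})
    (m2 : {measure set T2 -> \bar R}) (b : R) (Z1 : T1 -> T) (Z2 : T2 -> T)
    (f : T -> R) :
  measurable_fun setT Z1 -> measurable_fun setT Z2 -> measurable_fun setT f ->
  (forall A, measurable A -> nu1 A = (b%:E * m1 A)%E) ->
  (forall A, measurable A -> nu2 A = (b%:E * m2 A)%E) ->
  (forall A, measurable A -> m1 (Z1 @^-1` A) = m2 (Z2 @^-1` A)) ->
  cintegral nu1 (fun x => f (Z1 x)) = cintegral nu2 (fun x => f (Z2 x)).
Proof.
move=> mZ1 mZ2 mf nu1E nu2E m12; rewrite /cintegral /Rintegral.
have mfE : measurable_fun setT (EFin \o f) by exact/measurable_EFinP.
have mp A : measurable A -> measurable (Z1 @^-1` A) /\ measurable (Z2 @^-1` A).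
  by move=> mA; rewrite -[Z1 @^-1` A]setTI -[Z2 @^-1` A]setTI; split; [exact: mZ1|exact: mZ2].
congr (fine _ - fine _); apply: (eq_integral_push mZ1 mZ2 mfE) => A /[dup] mA /mp[mA1 mA2].
- apply: (eq_trans (jpos_scaled nu1E mA1)).
  by apply: (eq_trans _ (esym (jpos_scaled nu2E mA2))); rewrite m12.
- apply: (eq_trans (jneg_scaled nu1E mA1)).
  by apply: (eq_trans _ (esym (jneg_scaled nu2E mA2))); rewrite m12.
Qed.

Lemma mfun_opp3 d (T : measurableType d) (R : realType) (g : T -> R3 R) :
  measurable_fun setT g -> measurable_fun setT (fun x => - g x).
Proof.
by have [mo _ _ _] := @lin_isometry_opp R => mg; exact: (measurableT_comp mo mg).
Qed.

Section green_convolution.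
Context {R : realType} (c t t' : R).

Let a := (4 * pi * c ^+ 2 * t)^-1.
Let a' := (4 * pi * c ^+ 2 * t')^-1.
Let m := Defs.fprod (sphere_measure (c * `|t|)) (sphere_measure (c * `|t'|)).

Lemma cprod_greenE S : measurable S ->
  cprod (green c t) (green c t') S = ((a * a')%:E * m S)%E.
Proof.
move=> mS; apply: cprod_scaled => // A mA; exact: greenE.
Qed.

Let measurable_diff (x x' : R3 R) :
  measurable_fun setT (fun s : R3 R * R3 R => (x - s.1) - (x' - s.2)).
Proof.
have m1 : measurable_fun setT (fun s : R3 R * R3 R => x - s.1).
  by apply: mfun_add3; [mfun|apply: mfun_opp3; mfun].
have m2 : measurable_fun setT (fun s : R3 R * R3 R => x' - s.2).
  by apply: mfun_add3; [mfun|apply: mfun_opp3; mfun].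
exact: mfun_add3 m1 (mfun_opp3 m2).
Qed.

Let preim_add A : measurable A -> measurable (@add3 R @^-1` A).
Proof. by move=> mA; rewrite -[X in measurable X]setTI; exact: measurable_add3. Qed.

Lemma cconv_greenE A : measurable A ->
  cconv (green c t) (green c t') A = ((a * a')%:E * m (add3 @^-1` A))%E.
Proof. by move=> mA; apply: cprod_greenE; exact: preim_add. Qed.

Let reflect_second (x x' : R3 R) (A : set (R3 R)) : measurable A ->
  m [set s | A ((x - s.1) - (x' - s.2))] = m [set s | A ((x - x') - add3 s)].
Proof.
move=> mA.
have iso := @lin_isometry_opp R.
have mZ1 := measurable_diff x x'.
have mZ2 : measurable_fun setT (fun s : R3 R * R3 R => (x - x') - (s.1 + s.2)).
  by apply: mfun_add3; [exact: measurable_cst|apply: mfun_opp3; exact: measurable_add3].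
have mI : measurable_fun setT (fun h : R3 R => (\1_A h)%:E : \bar R).
  by apply/measurable_EFinP; exact: measurable_indic.
have n1 : ge0_mfun (fun s : R3 R * R3 R => (\1_A ((x - s.1) - (x' - s.2)))%:E : \bar R).
  by split; [exact: (measurableT_comp mI mZ1)|nneg].
have n2 : ge0_mfun (fun s : R3 R * R3 R => (\1_A ((x - x') - (s.1 + s.2)))%:E : \bar R).
  by split; [exact: (measurableT_comp mI mZ2)|nneg].
have E (Z : R3 R * R3 R -> R3 R) : measurable_fun setT Z ->
    m [set s | A (Z s)] = (\int[m]_s (\1_A (Z s))%:E)%E.
  move=> mZ; have mZA : measurable [set s | A (Z s)].
    by rewrite -[X in measurable X]setTI; exact: mZ.
  have h := integral_indic m measurableT mZA; rewrite setIT in h.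
  apply: (eq_trans (esym h)).
  by apply: eq_integral => s _; congr EFin; rewrite !indicE.
apply: (eq_trans (E _ mZ1)); apply: (eq_trans _ (esym (E _ mZ2))).
apply: (eq_trans (integral_fprod _ _ (F := fun p q => (\1_A ((x - p) - (x' - q)))%:E) n1)).
apply: (eq_trans _ (esym (integral_fprod _ _
  (F := fun p q => (\1_A ((x - x') - (p + q)))%:E) n2))).
apply: eq_integral => p _.
have np : ge0_mfun (fun q : R3 R => (\1_A ((x - x') - (p + q)))%:E : \bar R).
  split; last by nneg.
  have mp : measurable_fun setT (fun q : R3 R => (p, q)) by mfun.
  exact: (measurableT_comp (proj1 n2) mp).
rewrite -[RHS](sphere_isometry _ iso np); apply: eq_integral => q _.
by congr (\1_A _)%:E; rewrite !opprD !opprK !addrA; congr (_ + _); rewrite addrAC.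
Qed.

(** The kernel integrates kS ((x - x') - (p - q)) and the convolution kS ((x - x') - (p + q));
    these agree because the spheres are symmetric about the origin. *)
Lemma wave_kernelE (kv : R3 R * R3 R -> R) (kS : R3 R -> R) (x x' : R3 R) :
  measurable_fun setT kS -> stationary_with kv kS ->
  conv33 (cprod (green c t) (green c t')) kv (x, x') =
  conv3 (cconv (green c t) (green c t')) kS (x - x').
Proof.
move=> mk kvE; rewrite /conv33 /conv3.
have -> : (fun s => kv ((x, x') - s)) = (fun s => kS ((x - s.1) - (x' - s.2))).
  by apply/funext => s; rewrite -kvE; case: s.
pose m' := pushm m (@measurable_add3 R).
have mZ1 := measurable_diff x x'.
have mZ2 : measurable_fun setT (fun y : R3 R => (x - x') - y).
  by apply: mfun_add3; [exact: measurable_cst|apply: mfun_opp3; mfun].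
apply: (eq_cintegral_push (m1 := m) (m2 := m') (b := a * a') mZ1 mZ2 mk).
- exact: cprod_greenE.
- exact: cconv_greenE.
- by move=> A mA; exact: reflect_second.
Qed.

End green_convolution.

Section green_density.
Context {R : realType} (c t t' : R).
Hypothesis c0 : 0 < c.

Let a := (4 * pi * c ^+ 2 * t)^-1.
Let a' := (4 * pi * c ^+ 2 * t')^-1.
Let r := c * `|t|.
Let r' := c * `|t'|.
Let m := Defs.fprod (sphere_measure r) (sphere_measure r').

Let D (h : R3 R) : R :=
  2 * pi * r * r' / norm3 h * \1_(`[`|r - r'|, r + r']%classic) (norm3 h).

Let mD : measurable_fun setT D.
Proof.
have mn : measurable_fun setT (fun h : R3 R => norm3 h) by apply: mfun_norm3; mfun.
by rewrite /D; mfun.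
Qed.

Let D_ge0 h : 0 <= D h.
Proof.
have := pi_ge0 R => p0; have := ltW c0 => ?; have := norm3_ge0 h => ?.
by rewrite /D /r /r'; nneg.
Qed.

Let nD : ge0_mfun (EFin \o D).
Proof. by split; [exact/measurable_EFinP|move=> h; rewrite /= lee_fin]. Qed.

(** The density of [sphere_sum] for r = c |t| and r' = c |t'|, with the coefficients of [greenE].
    When t or t' is 0 both sides vanish. *)
Lemma green_densityE h : green_density c t t' h = a * a' * D h.
Proof.
have p0 : pi != 0 :> R by rewrite gt_eqF// pi_gt0.
have cn0 : c != 0 by rewrite gt_eqF.
rewrite /green_density /D.
have -> : `[c * `| `|t| - `|t'| |, c * (`|t| + `|t'|)]%classic = `[`|r - r'|, r + r']%classic :> set R.
  by rewrite /r /r' -mulrDr -mulrBr normrM (gtr0_norm c0).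
rewrite [RHS]mulrA; congr (_ * _).
have [t0|t0] := eqVneq t 0; first by rewrite /a t0 sgr0 mulr0 invr0 !mul0r.
have [t'0|t'0] := eqVneq t' 0; first by rewrite /a' t'0 sgr0 !mulr0 invr0 mulr0 !mul0r.
have sgE (x : R) : x != 0 -> Num.sg x = `|x| / x.
  by move=> x0; apply: (mulIf x0); rewrite mulfVK// normrEsg.
rewrite !sgE// /a /a' /r /r'.
have -> : (8 * pi * c ^+ 2 * norm3 h)^-1 = (8 * pi * c ^+ 2)^-1 * (norm3 h)^-1.
  by rewrite invfM.
rewrite [LHS]mulrA [RHS]mulrA; congr (_ * _).
(* field only treats pi as an atom once it is a variable. *)
move: (@pi R) p0 => P p0; field.
by rewrite t0 t'0 cn0 p0.
Qed.

Let sum_measure A : t != 0 -> t' != 0 -> measurable A ->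
  m (@add3 R @^-1` A) = (\int[lebesgue3]_(h in A) (D h)%:E)%E.
Proof.
move=> t0 t'0 mA.
have r0 : 0 < r by rewrite mulr_gt0 ?normr_gt0.
have r'0 : 0 < r' by rewrite mulr_gt0 ?normr_gt0.
have nA : ge0_mfun (fun h : R3 R => (\1_A h)%:E : \bar R).
  by split; [apply/measurable_EFinP; exact: measurable_indic|nneg].
have mpA : measurable (@add3 R @^-1` A).
  by rewrite -[X in measurable X]setTI; exact: measurable_add3.
have h := integral_indic m measurableT mpA; rewrite setIT in h.
apply: (eq_trans (esym h)); apply: (eq_trans _ (eq_trans (sphere_sum r0 r'0 nA) _)).
  by apply: eq_integral => z _; congr EFin; rewrite !indicE.
rewrite [RHS]integral_mkindic; apply: eq_integral => k _.
by rewrite muleC.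
Qed.

Lemma green_conv_density : has_density (cconv (green c t) (green c t')) lebesgue3
  (green_density c t t').
Proof.
have E : green_density c t t' = (fun h => a * a' * D h).
  by apply/funext => h; exact: green_densityE.
rewrite E.
have [tt|tt] := boolP ((t == 0) || (t' == 0)).
  have aa : a * a' = 0.
    by case/orP: tt => /eqP z; rewrite /a /a' z mulr0 invr0 ?mul0r ?mulr0.
  have Z : (fun h : R3 R => a * a' * D h) = (fun=> 0).
    by apply/funext => h; rewrite aa mul0r.
  rewrite Z; split; first exact: integrable0.
  move=> A mA; apply: (eq_trans (cconv_greenE c t t' mA)).
  by rewrite -/a -/a' aa mul0e integral0_eq.
move: tt; rewrite negb_or => /andP[t0 t'0].
have iD : lebesgue3.-integrable setT (EFin \o D).
  apply/integrableP; split; first exact: (proj1 nD).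
  rewrite (eq_integral (EFin \o D)); last first.
    by move=> h _ /=; rewrite ger0_norm.
  rewrite [X in (X < _)%E](_ : _ = m (@add3 R @^-1` setT)); last first.
    by rewrite sum_measure.
  by rewrite preimage_setT ltey_eq; apply/orP; left; exact: fin_num_measure.
split.
  have -> : EFin \o (fun h => a * a' * D h) = (fun h => (a * a')%:E * (EFin \o D) h)%E.
    by apply/funext => h /=; rewrite EFinM.
  exact: integrableZl.
move=> A mA; apply: (eq_trans (cconv_greenE c t t' mA)).
rewrite -/a -/a' -/r -/r' -/m sum_measure//.
rewrite -integralZl//; exact: integrableS iD.
Qed.

Lemma green_conv_dominated : cconv (green c t) (green c t') `<< lebesgue3.
Proof.
have [iD dens] := green_conv_density.
apply/null_content_dominatesP => A mA A0; rewrite dens//.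
rewrite null_set_integral//.
by apply: measurable_funTS; case/integrableP: iD.
Qed.

End green_density.

Theorem proposition3p2 (R : realType) (c : R) (kv : R3 R * R3 R -> R)
    (kS : R3 R -> R) (c_gt0 : 0 < c) (kv_psd : psd_kernel kv)
    (kv_continuous : continuous kv) (kv_stationary : stationary_with kv kS) :
  ((forall t t' : R,
      stationary (fun xx : R3 R * R3 R => kwave c kv (xx.1, t) (xx.2, t'))) /\
   (forall (x x' : R3 R) (t t' : R),
      conv33 (cprod (green c t) (green c t')) kv (x, x') =
      conv3 (cconv (green c t) (green c t')) kS (x - x'))) /\
  (forall t t' : R,
      cconv (green c t) (green c t') `<< lebesgue3 /\
      has_density (cconv (green c t) (green c t')) lebesgue3
        (green_density c t t')).
Proof.
have mk : measurable_fun setT kS.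
  apply: continuous_measurable3.
  have -> : kS = kv \o (fun h => (h, 0)).
    by apply/funext => h /=; rewrite kv_stationary subr0.
  move=> h; apply: continuous_comp; last exact: kv_continuous.
  apply: (@cvg_pair _ _ _ (nbhs h) (nbhs h) (nbhs (0 : R3 R)) _ _ _ (fun k => k) (fun=> 0)).
    exact: cvg_id.
  exact: cvg_cst.
split; last by move=> t t'; split; [exact: green_conv_dominated|exact: green_conv_density].
split; last by move=> x x' t t'; exact: wave_kernelE.
move=> t t'; exists (conv3 (cconv (green c t) (green c t')) kS) => x x'.
exact: wave_kernelE.
Qed.
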